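(* Let $M$ be a smooth manifold and let $\mathcal F: M\to \mathrm{Sym}_n(\mathbb F)$ be a smooth family whose eigenvalue $\lambda_k$ has multiplicity $\nu\ge1$ at the point $x\in M$. If $\mathcal F$ satisfies the non-degenerate criticality condition (N) at $x$, then there exists a submanifold $S\subset M$ such that for any $y$ in a small neighborhood of $x$ in $M$, the multiplicity of $\lambda_k(y)$ is equal to $\nu$ if and only if $y\in S$. This submanifold has the following properties: (1) $S$ has codimension $s(\nu):=\dim_{\mathbb R}\mathrm{Sym}_\nu(\mathbb F)-1$ in $M$; (2) the restriction $\lambda_k|_S$ is a smooth function which has a critical point at $x$, i.e. $d(\lambda_k|_S)(x)=0$.
   Context: $\mathbb F$ is $\mathbb R$ or $\mathbb C$, and $\mathrm{Sym}_n=\mathrm{Sym}_n(\mathbb F)$ is the real vector space of $n\times n$ real symmetric (if $\mathbb F=\mathbb R$) or complex Hermitian (if $\mathbb F=\mathbb C$) matrices. The eigenvalues of $A\in\mathrm{Sym}_n$ are numbered with multiplicity in increasing order, $\widehat\lambda_1(A)\le\dots\le\widehat\lambda_n(A)$. A smooth family on a smooth manifold $M$ is a $C^\infty$ map $\mathcal F:M\to\mathrm{Sym}_n$, and $\lambda_k:=\widehat\lambda_k\circ\mathcal F$, $1\le k\le n$. Compactness of $M$ is not required here. The multiplicity $\nu$ of $\lambda_k$ at $x$ is the multiplicity of $\lambda_k(x)$ as an eigenvalue of $\mathcal F(x)$, and $\mathbf E_k\subset\mathbb F^n$, $\dim \mathbf E_k=\nu$, is the corresponding eigenspace. Fix a linear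 isometry $\mathcal U:\mathbb F^\nu\to\mathbb F^n$ with range $\mathbf E_k$. The real-linear operator $\mathcal H_x:T_xM\to\mathrm{Sym}_\nu(\mathbb F)$ is $\mathcal H_x v:=\mathcal U^*\big(d\mathcal F(x)v\big)\mathcal U$. It depends on $\mathcal U$ only up to unitary conjugation, and the conditions used are independent of this choice. $\mathrm{Sym}_\nu^{++}$ is the set of positive definite matrices in $\mathrm{Sym}_\nu$. $(\cdot)^\perp$ is the orthogonal complement in $\mathrm{Sym}_\nu$ with respect to $\langle X,Y\rangle=\mathrm{Tr}(XY)$. Condition (N) at $x$ (for $\lambda_k$): $\left(\mathrm{Ran}\,\mathcal H_x\right)^\perp=\mathrm{span}\{B\}$ for some $B\in\mathrm{Sym}_\nu^{++}$. *)

(* Defs.v *)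
From HB Require Import structures.
From mathcomp Require Import all_boot all_order all_algebra.
From mathcomp Require Import all_classical all_reals all_analysis.
From mathcomp Require Import complex.

Set Implicit Arguments.
Unset Strict Implicit.
Unset Printing Implicit Defensive.

Import Order.TTheory GRing.Theory Num.Theory.
Import numFieldNormedType.Exports.

Local Open Scope classical_set_scope.
Local Open Scope ring_scope.

Section Smooth.
Context {R : realType} {V W : normedModType R}.

(* For finite-dimensional V and open U, this is the usual class C^k on U:
   Frechet differentiable with all directional derivatives of class C^(k-1). *)
Fixpoint Ck_on (k : nat) (U : set V) (f : V -> W) : Prop :=
  match k with
  | 0 => {in U, continuous f}
  | k'.+1 => (forall x, U x -> differentiable f x) /\
             (forall v, Ck_on k' U (fun x => 'D_v f x))
  end.

Definition smooth_on (U : set V) (f : V -> W) : Prop := forall k, Ck_on k U f.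

End Smooth.

Section Manifold.
Context {R : realType} {d : nat} {M : topologicalType}.

(* The values of chart_fun outside chart_dom, and of chart_inv outside
   chart_img, are irrelevant. *)
Record chart := Chart {
  chart_dom : set M;
  chart_fun :> M -> 'rV[R]_d;
  chart_inv : 'rV[R]_d -> M;
  chart_dom_open : open chart_dom;
  chart_img_open : open (chart_fun @` chart_dom);
  chart_fun_continuous : {in chart_dom, continuous chart_fun};
  chart_inv_continuous : {in chart_fun @` chart_dom, continuous chart_inv};
  chart_funK : {in chart_dom, cancel chart_fun chart_inv}
}.

Definition chart_img (c : chart) : set 'rV[R]_d := c @` chart_dom c.

Definition smooth_transition (c c' : chart) : Prop :=
  smooth_on (c @` (chart_dom c `&` chart_dom c')) (c' \o chart_inv c).

Record smooth_structure := SmoothStructure {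
  atlas : set chart;
  manifold_hausdorff : hausdorff_space M;
  manifold_second_countable : @second_countable M;
  atlas_cover : forall x : M, exists2 c, atlas c & chart_dom c x;
  atlas_compatible :
    forall c c', atlas c -> atlas c' -> smooth_transition c c'
}.

Variable A : smooth_structure.

(* Membership in the maximal atlas generated by atlas A. *)
Definition smooth_chart (c : chart) : Prop :=
  forall c', atlas A c' -> smooth_transition c c' /\ smooth_transition c' c.

Definition smooth_fun (f : M -> R) : Prop :=
  forall c, atlas A c -> smooth_on (chart_img c) (f \o chart_inv c).

(* A chart at x identifies the tangent space T_x M with R^d. *)
Definition chart_at (x : M) : chart := s2val (cid2 (atlas_cover A x)).

Definition tangent_space (x : M) : Type := 'rV[R]_d.

Definition mdiff (f : M -> R) (x : M) (v : tangent_space x) : R :=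
  'D_(v : 'rV[R]_d) (f \o chart_inv (chart_at x)) (chart_at x x).

(* For m <= d, the inclusion of R^m in R^d as R^m x {0}. *)
Definition slice_incl (m : nat) (t : 'rV[R]_m) : 'rV[R]_d := t *m pid_mx m.

Definition slice_chart (s : nat) (S : set M) (c : chart) : Prop :=
  smooth_chart c /\
  c @` (chart_dom c `&` S) = chart_img c `&` range (@slice_incl (d - s)).

(* Embedded submanifold of codimension s. *)
Definition submanifold (s : nat) (S : set M) : Prop :=
  (s <= d)%N /\
  forall p, S p -> exists2 c, slice_chart s S c & chart_dom c p.

(* The restrictions of the slice charts to S form the smooth atlas of S; the
   following is the expression of f|_S in the chart of S induced by c. *)
Definition restr_coord (s : nat) (f : M -> R) (c : chart) (t : 'rV[R]_(d - s))
    : R := f (chart_inv c (slice_incl t)).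

Definition smooth_on_submanifold (s : nat) (S : set M) (f : M -> R) : Prop :=
  forall c, slice_chart s S c ->
    smooth_on [set t | chart_img c (slice_incl t)] (restr_coord (s := s) f c).

Definition critical_on_submanifold
    (s : nat) (S : set M) (f : M -> R) (x : M) : Prop :=
  forall c, slice_chart s S c -> chart_dom c x ->
  forall t : 'rV[R]_(d - s), slice_incl t = c x ->
    'd (restr_coord (s := s) f c) t = 0 :> ('rV[R]_(d - s) -> R).

End Manifold.
Arguments chart R d M : clear implicits.
Arguments smooth_structure R d M : clear implicits.

Variant base_field := real_field | complex_field.

Definition rc_scalar (R : realType) (b : base_field) : numFieldType :=
  match b with real_field => R | complex_field => R[i] end.

Section Scalars.
Context {R : realType} {b : base_field}.

Definition rc_re : rc_scalar R b -> R :=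
  match b return rc_scalar R b -> R with
  | real_field => fun z => z
  | complex_field => fun z => complex.Re z
  end.

Definition rc_im : rc_scalar R b -> R :=
  match b return rc_scalar R b -> R with
  | real_field => fun=> 0
  | complex_field => fun z => complex.Im z
  end.

(* x + i y; only called with y = 0 when b = real_field. *)
Definition rc_of_parts : R -> R -> rc_scalar R b :=
  match b return R -> R -> rc_scalar R b with
  | real_field => fun x _ => x
  | complex_field => fun x y => (x +i* y)%C
  end.

Definition rc_of_real (x : R) : rc_scalar R b := rc_of_parts x 0.

Definition rc_conj (z : rc_scalar R b) : rc_scalar R b :=
  rc_of_parts (rc_re z) (- rc_im z).

Definition adjoint m n (X : 'M[rc_scalar R b]_(m, n)) : 'M[rc_scalar R b]_(n, m) :=
  (map_mx rc_conj X)^T.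

Definition Sym_mx n : set 'M[rc_scalar R b]_n := [set X | adjoint X = X].
Arguments Sym_mx : clear implicits.

Definition posdef n : set 'M[rc_scalar R b]_n :=
  [set B | Sym_mx n B /\
    forall v : 'cV[rc_scalar R b]_n, v != 0 -> 0 < (adjoint v *m B *m v) 0 0].

(* The nondecreasing list of the eigenvalues, with multiplicity, of a matrix
   whose eigenvalues are real. *)
Definition eigvals n (X : 'M[rc_scalar R b]_n) : seq R :=
  xget [::] [set s : seq R | sorted <=%R s /\
    char_poly X = \prod_(a <- s) ('X - (rc_of_real a)%:P)].

(* 0-based: k : 'I_n stands for the (k+1)-st eigenvalue. *)
Definition eigval n (k : 'I_n) (X : 'M[rc_scalar R b]_n) : R :=
  (eigvals X)`_k.

Definition eig_mult n (k : 'I_n) (X : 'M[rc_scalar R b]_n) : nat :=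
  \rank (eigenspace X (rc_of_real (eigval k X))).

(* Unlike eigenspace of mxalgebra, this one consists of column vectors. *)
Definition eig_cspace n (k : 'I_n) (X : 'M[rc_scalar R b]_n)
    : set 'cV[rc_scalar R b]_n :=
  [set w | X *m w = rc_of_real (eigval k X) *: w].

Definition isometry_onto n nu (U : 'M[rc_scalar R b]_(n, nu))
    (E : set 'cV[rc_scalar R b]_n) : Prop :=
  adjoint U *m U = 1%:M /\ range (fun w : 'cV[rc_scalar R b]_nu => U *m w) = E.

Definition real_span n (B : 'M[rc_scalar R b]_n) : set 'M[rc_scalar R b]_n :=
  range (fun a : R => rc_of_real a *: B).

Definition trace_perp n (L : set 'M[rc_scalar R b]_n) : set 'M[rc_scalar R b]_n :=
  [set X | Sym_mx n X /\ forall Y, L Y -> \tr (X *m Y) = 0].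

(* e is a basis over R of the real subspace L. *)
Definition real_basis n (L : set 'M[rc_scalar R b]_n) (D : nat)
    (e : 'I_D -> 'M[rc_scalar R b]_n) : Prop :=
  (forall i, L (e i)) /\
  (forall X, L X -> exists! a : 'rV[R]_D,
     X = \sum_(i < D) rc_of_real (a 0 i) *: e i).

Definition real_dim n (L : set 'M[rc_scalar R b]_n) : nat :=
  xget 0%N [set D | exists e : 'I_D -> 'M[rc_scalar R b]_n, real_basis L e].

End Scalars.
Arguments Sym_mx R b n : clear implicits.

Section Family.
Context {R : realType} {b : base_field} {d : nat} {M : topologicalType}.
Variables (A : smooth_structure R d M) (n : nat) (F : M -> 'M[rc_scalar R b]_n).

Definition smooth_family : Prop :=
  (forall y, Sym_mx R b n (F y)) /\
  (forall i j, smooth_fun A (fun y => rc_re (F y i j)) /\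
               smooth_fun A (fun y => rc_im (F y i j))).

Definition dfamily (x : M) (v : tangent_space (R := R) (d := d) x)
    : 'M[rc_scalar R b]_n :=
  \matrix_(i, j) rc_of_parts
    (mdiff A (fun y => rc_re (F y i j)) v)
    (mdiff A (fun y => rc_im (F y i j)) v).

Definition Hop (x : M) nu (U : 'M[rc_scalar R b]_(n, nu))
    (v : tangent_space (R := R) (d := d) x) : 'M[rc_scalar R b]_nu :=
  adjoint U *m dfamily v *m U.

Definition condition_N (x : M) nu (U : 'M[rc_scalar R b]_(n, nu)) : Prop :=
  exists2 B, posdef B & trace_perp (range (Hop (x := x) U)) = real_span B.

End Family.

(* Main.v *)
Require Import Defs.
From HB Require Import structures.
From mathcomp Require Import all_boot all_order all_fingroup all_algebra.
From mathcomp Require Import all_classical all_reals all_analysis.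
From mathcomp Require Import complex.
From mathcomp Require Import ring lra zify.

Set Implicit Arguments.
Unset Strict Implicit.
Unset Printing Implicit Defensive.

Import Order.TTheory GRing.Theory Num.Theory.
Import numFieldNormedType.Exports.

Local Open Scope classical_set_scope.
Local Open Scope ring_scope.

(* Work in a chart at x, write l0 for the value of lambda_k at x, and complete
   U to an invertible matrix [U W].  For (t, a) near (x, l0) the block
   W^* (F t - a) W is invertible, and a is an eigenvalue of F t of multiplicity
   nu exactly when the Schur complement Phi(t, a) of that block in
   [U W]^* (F t - a) [U W] vanishes; by the Weyl inequalities such an a is then
   lambda_k(t).  The term of Phi beyond U^* (F t - a) U vanishes to second
   order at (x, l0), so dPhi(v, w) = H v - w I.
   Condition (N) gives tr(B H v) = 0 and tr B > 0.  Hence tr(B Phi(t, a)) = 0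
   can be solved for a = l(t) by the implicit function theorem, with dl(x) = 0,
   and t |-> Phi(t, l(t)) takes its values in the orthogonal of B and has
   differential H at x, which is onto that orthogonal.  Its zero set S is
   therefore a submanifold of codimension dim Sym_nu - 1, on which
   lambda_k = l.  Real families are complexified to get the spectral theorem. *)

(** * Differentiability of matrix-valued functions *)

(** The obstacle is that [lambda_k] is in general only Lipschitz where eigenvalues split, and
    eigenvectors need not depend smoothly on the point. So only the entries of F are ever
    differentiated. The spectral parameter a is kept as a variable independent of t, which makes Phi
    a rational, hence smooth, expression in a and the entries of F. The function l is a smooth
    substitute for [lambda_k]; the two agree on S and in general not elsewhere. Since tr B is the
    pairing of B with the identity, its positivity says that shifting the eigenvalue moves Phi
    transversally to the orthogonal of B, so that a can be eliminated. The elimination spends one of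
    the D = dim Sym_nu real equations Phi = 0. The remaining system is still written with D
    equations, but all its values lie in a fixed space of dimension D - 1 onto which its
    differential maps. A linear change of coordinates therefore extracts D - 1 independent
    equations, and the inverse function theorem finishes without a constant rank theorem. Smooth
    dependence on the point is always tested on real and imaginary parts, so that both base fields
    share one argument. *)

Section MatrixNorm.
Context {R : realType} {m n : nat}.
Implicit Types M : 'M[R]_(m, n).

Lemma norm_entry_le M i j : `|M i j| <= `|M|.
Proof.
by rewrite [leRHS]/Num.Def.normr /= mx_normrE; exact: (le_bigmax _ _ (i, j)).
Qed.

Lemma mx_norm_le M (e : R) :
  0 <= e -> (forall i j, `|M i j| <= e) -> `|M| <= e.
Proof.
move=> e0 Me; rewrite [leLHS]/Num.Def.normr /= mx_normrE.
by apply: bigmax_le => // -[i j] _; exact: Me.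
Qed.

(** The norm is the maximum over finitely many entries; indexing the estimates by pairs lets
    [filter_forall] make them hold simultaneously. *)
Lemma cvg_mx (T : Type) (F : set_system T) (FF : Filter F) (f : T -> 'M[R]_(m, n)) M :
  (forall i j, f x i j @[x --> F] --> M i j) -> f x @[x --> F] --> M.
Proof.
move=> fM; apply/cvgrPdist_le => e e0; near=> x.
apply: mx_norm_le; first exact: ltW.
move=> i j; rewrite !mxE.
move: i j; near: x.
have H : \forall x \near F, forall p : 'I_m * 'I_n, `|M p.1 p.2 - f x p.1 p.2| <= e.
  by apply: filter_forall => -[i j] /=; exact: (cvgrPdist_le _ _).1 (fM i j) _ e0.
by apply: filterS H => x H i j; exact: (H (i, j)).
Unshelve. all: by end_near. Qed.

End MatrixNorm.

Section Differentiability.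
Context {R : realType}.

(** Entry point for explicit estimates: the little-o behind [differentiable] is unfolded here, and
    [diff_unique] identifies the differential at the same time. *)
Lemma differentiable_eps (V W : normedModType R) (f : V -> W) x
    (L : {linear V -> W}) :
  continuous L ->
  (forall e, 0 < e -> \forall h \near (0 : V), `|f (h + x) - f x - L h| <= e * `|h|) ->
  differentiable f x /\ 'd f x = L :> (V -> W).
Proof.
move=> Lc fL.
have E : f \o shift x = cst (f x) + L +o_ 0 id.
  apply/eqaddoP => _ /posnumP[e]; apply: filterS (fL _ (gt0 e)) => h.
  by rewrite /= !fctE opprD addrA.
have dE := diff_unique Lc E.
by split=> //; apply/diff_locallyP; rewrite dE.
Qed.

Lemma differentiable_mx (V : normedModType R) m n (f : V -> 'M[R]_(m, n)) x :
  (forall i j, differentiable (fun y => f y i j) x) -> differentiable f x.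
Proof.
move=> df.
pose L v := \matrix_(i, j) 'd (fun y => f y i j) x v : 'M[R]_(m, n).
have Llin : linear L.
  by move=> a u v; apply/matrixP => i j; rewrite !mxE linearP.
pose LM := GRing.isLinear.Build _ _ _ _ _ Llin.
pose LL : {linear V -> 'M[R]_(m, n)} := HB.pack L LM.
have [//||//] := @differentiable_eps _ _ f x LL.
- move=> v; apply: cvg_mx => i j /=.
  under eq_cvg do rewrite mxE.
  rewrite mxE; exact: (diff_continuous (df i j)).
- move=> e e0; near=> h.
  apply: mx_norm_le; first by rewrite mulr_ge0 // ltW.
  move=> i j; rewrite !mxE.
  move: i j; near: h.
  have H : \forall h \near (0 : V), forall p : 'I_m * 'I_n,
      `|f (h + x) p.1 p.2 - f x p.1 p.2 - 'd (fun y => f y p.1 p.2) x h| <= e * `|h|.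
    apply: filter_forall => -[i j] /=.
    have /eqaddoP := diff_locally (df i j).
    move=> /(_ e e0); apply: filterS => h /=.
    by rewrite !fctE opprD addrA.
  by apply: filterS H => h H i j; exact: (H (i, j)).
Unshelve. all: by end_near. Qed.

Lemma differentiable_entry (V : normedModType R) m n (f : V -> 'M[R]_(m, n)) x i j :
  differentiable f x -> differentiable (fun y => f y i j) x.
Proof.
move=> df; apply: (@differentiable_comp _ _ _ _ f (fun M => M i j)) => //.
exact: differentiable_coord.
Qed.

Lemma derive_entry (V : normedModType R) m n (f : V -> 'M[R]_(m, n)) x v i j :
  differentiable f x -> ('D_v f x) i j = 'D_v (fun y => f y i j) x.
Proof. by move=> df; rewrite derive_mx ?mxE //; exact: diff_derivable. Qed.

Lemma near_eq_differentiable (V W : normedModType R) (f g : V -> W) x :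
  {near x, f =1 g} -> differentiable f x -> differentiable g x.
Proof.
move=> fg df; have [//||//] := @differentiable_eps _ _ g x ('d f x).
  exact: diff_continuous.
move=> e e0; have /eqaddoP /(_ e e0) H := diff_locally df.
have fg0 : \forall h \near (0 : V), f (h + x) = g (h + x).
  have := fg; rewrite (near_shift 0) /=; apply: filterS => h /=.
  by rewrite subr0.
near=> h.
rewrite -(nbhs_singleton fg) -(near fg0 h) //.
have : `|(f \o shift x - (cst (f x) + 'd f x)) h| <= e * `|h| by near: h.
by rewrite !fctE opprD addrA.
Unshelve. all: by end_near. Qed.

End Differentiability.

(** * Calculus of the classes [Ck_on] *)

Section CkCalculus.
Context {R : realType}.

Lemma Ck_on0P (V W : normedModType R) (U : set V) (f : V -> W) :
  Ck_on 0 U f <-> forall x, U x -> {for x, continuous f}.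
Proof.
by split=> [fc x Ux|fc x /set_mem Ux]; [apply: fc; rewrite inE|exact: fc].
Qed.

Lemma open_near_eq (V : topologicalType) (W : Type) (U : set V) (f g : V -> W) x :
  open U -> (forall y, U y -> f y = g y) -> U x -> {near x, f =1 g}.
Proof.
move=> oU fg Ux; have : nbhs x U by exact: open_nbhs_nbhs.
by apply: filterS => y; exact: fg.
Qed.

(** On an open set, agreement on [U] is agreement near each point, hence passes to derivatives. The
    closure lemmas below use this to replace a derivative by its formula. *)
Lemma eq_Ck_on k (V W : normedModType R) (U : set V) (f g : V -> W) :
  open U -> (forall y, U y -> f y = g y) -> Ck_on k U f -> Ck_on k U g.
Proof.
move=> oU; elim: k f g => [|k IH] f g fg.
  move=> /Ck_on0P fc; apply/Ck_on0P => x Ux.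
  have nfg := open_near_eq oU fg Ux.
  rewrite /prop_for /continuous_at -(fg _ Ux).
  by apply: cvg_trans (fc _ Ux); exact: near_eq_cvg.
move=> [df cf]; split=> [x Ux|v].
  exact: near_eq_differentiable (open_near_eq oU fg Ux) (df _ Ux).
apply: IH (cf v) => y Uy; apply: near_eq_derive.
exact: (open_near_eq oU fg Uy).
Qed.

Lemma Ck_on_subset k (V W : normedModType R) (U U' : set V) (f : V -> W) :
  U' `<=` U -> Ck_on k U f -> Ck_on k U' f.
Proof.
move=> sU; elim: k f => [|k IH] f.
  by move=> /Ck_on0P fc; apply/Ck_on0P => x /sU; exact: fc.
by move=> [df cf]; split=> [x /sU|v]; [exact: df|exact: IH _ (cf v)].
Qed.

Lemma Ck_onW k (V W : normedModType R) (U : set V) (f : V -> W) :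
  Ck_on k.+1 U f -> Ck_on k U f.
Proof.
elim: k f => [|k IH] f [df cf].
  by apply/Ck_on0P => x /df; exact: differentiable_continuous.
by split=> // v; exact: IH _ (cf v).
Qed.

Lemma Ck_on_cst k (V W : normedModType R) (U : set V) (a : W) :
  Ck_on k U (fun=> a : W).
Proof.
elim: k a => [|k IH] a; first by apply/Ck_on0P => x _; exact: cst_continuous.
split=> [x _|v]; first exact: differentiable_cst.
have -> : (fun x => 'D_v (fun=> a) x) = fun=> 0 :> W.
  by apply/funext => x; rewrite (derive_cst a).
exact: IH.
Qed.

Lemma Ck_on_linear k (V W : normedModType R) (U : set V) (L : {linear V -> W}) :
  continuous L -> Ck_on k U L.
Proof.
move=> Lc; case: k => [|k]; first by apply/Ck_on0P => x _; exact: Lc.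
split=> [x _|v]; first exact: linear_differentiable.
have -> : (fun x => 'D_v L x) = fun=> L v.
  by apply/funext => x; rewrite deriveE ?diff_lin //; exact: linear_differentiable.
exact: Ck_on_cst.
Qed.

Lemma Ck_on_linear_comp k (V W X : normedModType R) (U : set V) (f : V -> W)
    (L : {linear W -> X}) :
  open U -> continuous L -> Ck_on k U f -> Ck_on k U (L \o f).
Proof.
move=> oU Lc; elim: k f => [|k IH] f.
  move=> /Ck_on0P fc; apply/Ck_on0P => x Ux.
  by apply: continuous_comp; [exact: fc|exact: Lc].
move=> [df cf]; split=> [x Ux|v].
  by apply: differentiable_comp; [exact: df|exact: linear_differentiable].
apply: eq_Ck_on (IH _ (cf v)) => // y Uy /=.
have Ld : differentiable L (f y) by exact: linear_differentiable.
rewrite deriveE; last exact: df.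
rewrite deriveE; last by apply: differentiable_comp => //; exact: df.
by rewrite (diff_comp (df _ Uy) Ld) /= (diff_lin _ Lc).
Qed.

Lemma Ck_onD k (V W : normedModType R) (U : set V) (f g : V -> W) :
  open U -> Ck_on k U f -> Ck_on k U g -> Ck_on k U (fun x => f x + g x).
Proof.
move=> oU; elim: k f g => [|k IH] f g.
  move=> /Ck_on0P fc /Ck_on0P gc; apply/Ck_on0P => x Ux.
  by apply: cvgD; [exact: fc|exact: gc].
move=> [df cf] [dg cg]; split=> [x Ux|v].
  by apply: differentiableD; [exact: df|exact: dg].
apply: eq_Ck_on (IH _ _ (cf v) (cg v)) => // y Uy.
by rewrite -deriveD //; apply: diff_derivable; [exact: df|exact: dg].
Qed.

Lemma Ck_onN k (V W : normedModType R) (U : set V) (f : V -> W) :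
  open U -> Ck_on k U f -> Ck_on k U (fun x => - f x).
Proof.
move=> oU; elim: k f => [|k IH] f.
  by move=> /Ck_on0P fc; apply/Ck_on0P => x Ux; apply: cvgN; exact: fc.
move=> [df cf]; split=> [x Ux|v].
  by apply: differentiableN; exact: df.
apply: eq_Ck_on (IH _ (cf v)) => // y Uy.
by rewrite -deriveN //; apply: diff_derivable; exact: df.
Qed.

Lemma Ck_on_sum k (V W : normedModType R) (U : set V) (I : Type) (r : seq I)
    (f : I -> V -> W) :
  open U -> (forall i, Ck_on k U (f i)) -> Ck_on k U (fun x => \sum_(i <- r) f i x).
Proof.
move=> oU cf; elim: r => [|i r IH].
  by under eq_fun do rewrite big_nil; exact: Ck_on_cst.
by under eq_fun do rewrite big_cons; apply: Ck_onD.
Qed.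

Lemma Ck_onM k (V : normedModType R) (U : set V) (f g : V -> R) :
  open U -> Ck_on k U f -> Ck_on k U g -> Ck_on k U (fun x => f x * g x).
Proof.
move=> oU; elim: k f g => [|k IH] f g.
  move=> /Ck_on0P fc /Ck_on0P gc; apply/Ck_on0P => x Ux.
  by apply: cvgM; [exact: fc|exact: gc].
move=> Cf Cg; have [df cf] := Cf; have [dg cg] := Cg; split=> [x Ux|v].
  by apply: differentiableM; [exact: df|exact: dg].
have := Ck_onD oU (IH _ _ (Ck_onW Cf) (cg v)) (IH _ _ (Ck_onW Cg) (cf v)).
apply: eq_Ck_on => // y Uy.
by rewrite (deriveM (f := f) (g := g)) //; apply: diff_derivable; [exact: df|exact: dg].
Qed.

(** The derivative -(1/f)^2 f' contains 1/f again, so the induction is on the order alone, with [f]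
    fixed. *)
Lemma Ck_onV k (V : normedModType R) (U : set V) (f : V -> R) :
  open U -> (forall x, U x -> f x != 0) -> Ck_on k U f ->
  Ck_on k U (fun x => (f x)^-1).
Proof.
move=> oU f0; elim: k => [|k IH].
  move=> /Ck_on0P fc; apply/Ck_on0P => x Ux.
  by apply: cvgV; [exact: f0|exact: fc].
move=> Cf; have [df cf] := Cf; split=> [x Ux|v].
  by apply: differentiableV; [exact: df|exact: f0].
have Ci := IH (Ck_onW Cf).
have := Ck_onN oU (Ck_onM oU (Ck_onM oU Ci Ci) (cf v)).
apply: eq_Ck_on => // y Uy.
rewrite (deriveV (f := f)); [|exact: f0|by apply: diff_derivable; exact: df].
by rewrite -invfM -expr2 -mulNr.
Qed.

Lemma Ck_on_entry k (V : normedModType R) m n (U : set V) (f : V -> 'M[R]_(m, n)) i j :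
  open U -> Ck_on k U f -> Ck_on k U (fun x => f x i j).
Proof.
move=> oU; elim: k f => [|k IH] f.
  move=> /Ck_on0P fc; apply/Ck_on0P => x Ux.
  by apply: (@continuous_comp _ _ _ f (fun M => M i j)); [exact: fc|exact: coord_continuous].
move=> [df cf]; split=> [x Ux|v]; first exact: differentiable_entry (df _ Ux).
by apply: eq_Ck_on (IH _ (cf v)) => // y Uy; rewrite derive_entry //; exact: df.
Qed.

Lemma Ck_on_mx k (V : normedModType R) m n (U : set V) (f : V -> 'M[R]_(m, n)) :
  open U -> (forall i j, Ck_on k U (fun x => f x i j)) -> Ck_on k U f.
Proof.
move=> oU; elim: k f => [|k IH] f cf.
  apply/Ck_on0P => x Ux; apply: cvg_mx => i j.
  exact: (Ck_on0P _ _).1 (cf i j) _ Ux.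
have df x : U x -> differentiable f x.
  by move=> Ux; apply: differentiable_mx => i j; exact: (cf i j).1.
split=> // v; apply: IH => i j; apply: eq_Ck_on ((cf i j).2 v) => // y Uy.
by rewrite derive_entry //; exact: df.
Qed.

Lemma derive_comp_rV (V : normedModType R) (W : normedModType R) m (f : V -> 'rV[R]_m)
    (g : 'rV[R]_m -> W) x v :
  differentiable f x -> differentiable g (f x) ->
  'D_v (g \o f) x = 'D_('D_v f x) g (f x).
Proof.
move=> df dg; rewrite deriveE; last exact: differentiable_comp.
by rewrite diff_comp // [RHS]deriveE //= [in RHS]deriveE.
Qed.

Lemma derive_rV_sum (W : normedModType R) m (g : 'rV[R]_m -> W) x v :
  differentiable g x ->
  'D_v g x = \sum_j v 0 j *: 'D_(delta_mx 0 j) g x.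
Proof.
move=> dg; rewrite deriveE // [in LHS](row_sum_delta v) linear_sum.
by apply: eq_bigr => j _; rewrite linearZ deriveE.
Qed.

(** The chain rule differentiates [g] in the moving direction ['D_v f x], whereas [Ck_on] controls
    fixed directions only. Expanding the direction in the standard basis leaves partial derivatives
    of [g] composed with the same [f], to which the induction applies. *)
Lemma Ck_on_comp k (V : normedModType R) m (U : set V) (U' : set 'rV[R]_m)
    (f : V -> 'rV[R]_m) (g : 'rV[R]_m -> R) :
  open U -> open U' -> (forall x, U x -> U' (f x)) ->
  Ck_on k U f -> Ck_on k U' g -> Ck_on k U (g \o f).
Proof.
move=> oU oU' UU'; elim: k g => [|k IH] g.
  move=> /Ck_on0P fc /Ck_on0P gc; apply/Ck_on0P => x Ux.
  by apply: continuous_comp; [exact: fc|apply: gc; exact: UU'].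
move=> Cf Cg; have [df cf] := Cf; have [dg cg] := Cg; split=> [x Ux|v].
  by apply: differentiable_comp; [exact: df|apply: dg; exact: UU'].
have : Ck_on k U (fun x => \sum_j ('D_v f x) 0 j * 'D_(delta_mx 0 j) g (f x)).
  apply: Ck_on_sum => // j; apply: Ck_onM => //.
    exact: Ck_on_entry (cf v).
  by apply: (IH (fun z => 'D_(delta_mx 0 j) g z)); [exact: Ck_onW Cf|exact: cg].
apply: eq_Ck_on => // y Uy.
have dfy := df _ Uy; have dgy := dg _ (UU' _ Uy).
by rewrite derive_comp_rV // derive_rV_sum.
Qed.

Lemma Ck_on_comp_mx k (V : normedModType R) m p q (U : set V) (U' : set 'rV[R]_m)
    (f : V -> 'rV[R]_m) (g : 'rV[R]_m -> 'M[R]_(p, q)) :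
  open U -> open U' -> (forall x, U x -> U' (f x)) ->
  Ck_on k U f -> Ck_on k U' g -> Ck_on k U (g \o f).
Proof.
move=> oU oU' UU' Cf Cg; apply: Ck_on_mx => // i j.
by apply: (Ck_on_comp (g := fun z => g z i j)) UU' Cf _ => //; exact: Ck_on_entry.
Qed.

Lemma Ck_on_continuous k (V W : normedModType R) (U : set V) (f : V -> W) x :
  Ck_on k U f -> U x -> {for x, continuous f}.
Proof.
elim: k => [/Ck_on0P|k IH /Ck_onW]; [exact|exact: IH].
Qed.

Lemma continuous_mulmxr m n p (B : 'M[R]_(n, p)) :
  continuous (fun A : 'M[R]_(m, n) => A *m B).
Proof.
move=> A; apply: (@cvg_mx _ _ _ _ _ (nbhs_filter A)) => i j; rewrite mxE.
under eq_fun do rewrite mxE.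
have /Ck_on0P/(_ A I) : Ck_on 0 setT (fun M : 'M[R]_(m, n) => \sum_l M i l * B l j).
  apply: Ck_on_sum => [|l]; first exact: openT.
  apply: Ck_onM; [exact: openT| |exact: Ck_on_cst].
  by apply/Ck_on0P => M _; exact: coord_continuous.
exact.
Qed.

Lemma Ck_on_mulmxr k (V : normedModType R) (U : set V) m n p
    (f : V -> 'M[R]_(m, n)) (B : 'M[R]_(n, p)) :
  open U -> Ck_on k U f -> Ck_on k U (fun x => f x *m B).
Proof.
move=> oU Cf; apply: (@Ck_on_linear_comp _ _ _ _ _ f (mulmxr B)) => //.
exact: continuous_mulmxr.
Qed.

Lemma Ck_on_mulmx k (V : normedModType R) (U : set V) m n p
    (f : V -> 'M[R]_(m, n)) (g : V -> 'M[R]_(n, p)) :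
  open U -> Ck_on k U f -> Ck_on k U g -> Ck_on k U (fun x => f x *m g x).
Proof.
move=> oU Cf Cg; apply: Ck_on_mx => // i j; under eq_fun do rewrite mxE.
by apply: Ck_on_sum => // l; apply: Ck_onM => //; exact: Ck_on_entry.
Qed.

End CkCalculus.

(** * Inverse and implicit function theorems *)

Section FunctionAlgebra.
Context {T : Type} {K : fieldType} (U : set T) (P : (T -> K) -> Prop).
Hypothesis P_eq : forall f g, (forall x, U x -> f x = g x) -> P f -> P g.
Hypothesis P_cst : forall a, P (fun=> a).
Hypothesis P_add : forall f g, P f -> P g -> P (fun x => f x + g x).
Hypothesis P_mul : forall f g, P f -> P g -> P (fun x => f x * g x).
Hypothesis P_inv : forall f, (forall x, U x -> f x != 0) -> P f ->
  P (fun x => (f x)^-1).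

Lemma closed_sum (I : Type) (r : seq I) (f : I -> T -> K) :
  (forall i, P (f i)) -> P (fun x => \sum_(i <- r) f i x).
Proof.
move=> Pf; elim: r => [|i r IH].
  by under eq_fun do rewrite big_nil; exact: P_cst.
by under eq_fun do rewrite big_cons; exact: P_add.
Qed.

Lemma closed_prod (I : Type) (r : seq I) (f : I -> T -> K) :
  (forall i, P (f i)) -> P (fun x => \prod_(i <- r) f i x).
Proof.
move=> Pf; elim: r => [|i r IH].
  by under eq_fun do rewrite big_nil; exact: P_cst.
by under eq_fun do rewrite big_cons; exact: P_mul.
Qed.

Lemma closed_det n (M : T -> 'M[K]_n) :
  (forall i j, P (fun x => M x i j)) -> P (fun x => \det (M x)).
Proof.
move=> PM; apply: closed_sum => s; apply: P_mul; first exact: P_cst.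
by apply: closed_prod => i; exact: PM.
Qed.

Lemma closed_mulmx m n p (M : T -> 'M[K]_(m, n)) (N : T -> 'M[K]_(n, p)) :
  (forall i j, P (fun x => M x i j)) -> (forall i j, P (fun x => N x i j)) ->
  forall i j, P (fun x => (M x *m N x) i j).
Proof.
move=> PM PN i j; under eq_fun do rewrite mxE.
by apply: closed_sum => l; exact: P_mul.
Qed.

(** Cramer's rule expresses the entries by cofactors and the determinant. The class [P] is abstract
    because the result serves twice: for [Ck_on] with real matrices and for [Ck_scalar] with
    matrices over the base field. *)
Lemma closed_invmx n (M : T -> 'M[K]_n) :
  (forall x, U x -> M x \in unitmx) ->
  (forall i j, P (fun x => M x i j)) -> forall i j, P (fun x => invmx (M x) i j).
Proof.
move=> Mu PM i j.
have : P (fun x => (\det (M x))^-1 * cofactor (M x) j i).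
  apply: P_mul.
    apply: P_inv; last exact: closed_det.
    by move=> x /Mu; rewrite unitmxE unitfE.
  apply: P_mul; first exact: P_cst.
  by apply: closed_det => i' j'; under eq_fun do rewrite !mxE; exact: PM.
by apply: P_eq => x Ux; rewrite /invmx Mu // !mxE.
Qed.

End FunctionAlgebra.

Section InverseFunction.
Context {R : realType}.

Lemma Ck_on_invmx k (V : normedModType R) n (U : set V) (M : V -> 'M[R]_n) :
  open U -> (forall x, U x -> M x \in unitmx) -> Ck_on k U M ->
  Ck_on k U (fun x => invmx (M x)).
Proof.
move=> oU Mu CM; apply: Ck_on_mx => // i j.
apply: (@closed_invmx _ R U (fun f => Ck_on k U f)) => //.
- by move=> f g fg; exact: eq_Ck_on.
- by move=> a; exact: Ck_on_cst.
- by move=> f g; exact: Ck_onD.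
- by move=> f g; exact: Ck_onM.
- by move=> f; exact: Ck_onV.
- by move=> i' j'; exact: Ck_on_entry.
Qed.

Lemma derive_line (V W : normedModType R) (f : V -> W) (a v : V) (t : R) :
  differentiable f (a + t *: v) ->
  is_derive t 1 (fun s : R => f (a + s *: v)) ('D_v f (a + t *: v)).
Proof.
move=> df.
pose g (s : R) := a + s *: v.
have [dg gE] : differentiable g t /\ forall s, 'd g t s = s *: v.
  have Hg : is_diff t g (0 + *:%R ^~ v) by exact: is_diffD.
  by split=> [|s]; [exact: ex_diff|rewrite diff_val /= add0r].
have dfg : differentiable (f \o g) t by exact: differentiable_comp.
apply: DeriveDef; first exact: diff_derivable dfg.
rewrite (_ : (fun s : R => _) = f \o g) // deriveE // diff_comp //= gE scale1r.
by rewrite deriveE.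
Qed.

Lemma ball_segment m (a x y : 'rV[R]_m) (r t : R) :
  ball a r x -> ball a r y -> 0 <= t <= 1 -> ball a r (y + t *: (x - y)).
Proof.
rewrite -!ball_normE /= => ax ay /andP[t0 t1].
have -> : a - (y + t *: (x - y)) = t *: (a - x) + (1 - t) *: (a - y).
  by apply/matrixP => i j; rewrite !mxE; ring.
apply: le_lt_trans (ler_normD _ _) _; rewrite !normrZ ger0_norm //.
rewrite (ger0_norm (_ : 0 <= 1 - t)) ?subr_ge0 //.
have [->|tn0] := eqVneq t 0; first by rewrite mul0r add0r subr0 mul1r.
have tp : 0 < t by rewrite lt_def tn0.
have -> : r = t * r + (1 - t) * r by rewrite -mulrDl addrC subrK mul1r.
apply: ltr_leD; first by rewrite ltr_pM2l.
by rewrite ler_wpM2l ?subr_ge0 // ltW.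
Qed.

(** The factor [m] arises because the derivative along [x - y] is a sum of [m] partial derivatives,
    each weighted by an entry of [x - y] and so bounded by [c] times the sup norm. *)
Lemma mean_value_le m (h : 'rV[R]_m -> R) (a : 'rV[R]_m) (r c : R) :
  (forall x : 'rV[R]_m, ball a r x -> differentiable h x) ->
  (forall (x : 'rV[R]_m) j, ball a r x -> `|'D_(delta_mx 0 j) h x| <= c) ->
  forall x y : 'rV[R]_m, ball a r x -> ball a r y -> `|h x - h y| <= m%:R * c * `|x - y|.
Proof.
move=> dh hc x y ax ay.
pose g (s : R) := h (y + s *: (x - y)).
have dg (s : R) : 0 <= s <= 1 -> is_derive s 1 g ('D_(x - y) h (y + s *: (x - y))).
  by move=> s01; apply: derive_line; apply: dh; exact: ball_segment.
have [z z01 zE] : exists2 z, z \in `]0, 1[%R &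
    g 1 - g 0 = 'D_(x - y) h (y + z *: (x - y)) * (1 - 0).
  apply: (@MVT _ g (fun s => 'D_(x - y) h (y + s *: (x - y)))) => //.
    by move=> s; rewrite in_itv /= => /andP[s0 s1]; apply: dg; rewrite !ltW.
  apply: derivable_within_continuous => s; rewrite in_itv /= => s01.
  by have [] := dg s s01.
move: zE; rewrite /g scale1r scale0r addr0 (addrC y) subrK subr0 mulr1 => ->.
have bz : ball a r (y + z *: (x - y)).
  by apply: ball_segment => //; move: z01; rewrite in_itv /= => /andP[? ?]; rewrite !ltW.
rewrite derive_rV_sum; last exact: dh.
apply: le_trans (ler_norm_sum _ _ _) _.
apply: le_trans (_ : \sum_(j < m) c * `|x - y| <= _); last first.
  by rewrite sumr_const card_ord -[leLHS]mulr_natl mulrA.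
apply: ler_sum => j _; rewrite normrZ mulrC.
by rewrite ler_pM // ?hc // norm_entry_le.
Qed.

(* The fixed point minimizes |T x - x| over the compact ball. *)
Lemma contraction_fixpoint m (T : 'rV[R]_m -> 'rV[R]_m) (x0 : 'rV[R]_m) (d q : R) :
  0 <= d -> q < 1 ->
  (forall x, `|x - x0| <= d -> `|T x - x0| <= d) ->
  (forall x y, `|x - x0| <= d -> `|y - x0| <= d -> `|T x - T y| <= q * `|x - y|) ->
  exists2 x, `|x - x0| <= d & T x = x.
Proof.
move=> d0 q1 TK Tq; pose K := [set x | `|x - x0| <= d].
have KE : K = closed_ball_ (fun z => `|z|) x0 d.
  by apply/seteqP; split=> x; rewrite /K /closed_ball_ /= distrC.
have cK : compact K.
  apply: bounded_closed_compact.
    exists (d + `|x0|); split; first by rewrite num_real.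
    move=> M MH x Kx; rewrite /=; apply: ltW; apply: le_lt_trans MH.
    by rewrite -(subrK x0 x); apply: le_trans (ler_normD _ _) _; rewrite lerD.
  by rewrite KE; exact: closed_closed_ball_.
have K0 : K !=set0 by exists x0; rewrite /K /= subrr normr0.
have [x Kx xmin] : exists2 c, c \in K & forall t, t \in K -> `|T c - c| <= `|T t - t|.
  apply: (@EVT_min_rV _ _ (fun x => `|T x - x|)) => //.
  apply/subspace_continuousP => x Kx; apply/cvgrPdist_le => e e0.
  have k0 : 0 < `|q| + 1 by rewrite ltr_wpDl.
  near=> y.
  have Ky : K y by near: y; exact: withinT.
  apply: le_trans (ler_dist_dist _ _) _.
  have -> : T x - x - (T y - y) = (T x - T y) + (y - x).
    by apply/matrixP => i j; rewrite !mxE; ring.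
  apply: le_trans (ler_normD _ _) _.
  apply: le_trans (_ : (`|q| + 1) * `|y - x| <= _).
    rewrite mulrDl mul1r lerD2r.
    apply: le_trans (Tq _ _ Kx Ky) _.
    by rewrite distrC ler_wpM2r // ler_norm.
  rewrite -ler_pdivlMl //.
  near: y; apply: cvg_within; apply/nbhs_ballP.
  exists ((`|q| + 1)^-1 * e); first by rewrite /= mulr_gt0 ?invr_gt0.
  by move=> z; rewrite -ball_normE /= distrC => /ltW.
have Kx' : `|x - x0| <= d by move/set_mem : Kx.
exists x => //; apply/eqP; rewrite -subr_eq0 -normr_le0 leNgt; apply/negP => hp.
have : T x \in K by rewrite inE; exact: TK.
move=> /xmin; apply/negP; rewrite -ltNge.
apply: le_lt_trans (Tq _ _ (TK _ Kx') Kx') _.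
by rewrite gtr_pMl.
Unshelve. all: by end_near. Qed.

(** With identity derivative at [a], the map is the identity plus a perturbation [p] that is
    1/2-Lipschitz on a small ball. Injectivity, openness of the image and invertibility of the
    Jacobian on the whole ball all follow from this single bound. *)
Lemma inverse_function_id m (U : set 'rV[R]_m) (f : 'rV[R]_m -> 'rV[R]_m) a :
  open U -> U a -> smooth_on U f -> (forall v, 'D_v f a = v) ->
  exists V, exists g : 'rV[R]_m -> 'rV[R]_m,
    [/\ open V, V `<=` U, V a, open (f @` V) &
        (forall x, V x -> g (f x) = x) /\ smooth_on (f @` V) g].
Proof.
move=> oU Ua sf fa.
have df x : U x -> differentiable f x by exact: (sf 1%N).1.
(* Chosen so that [m%:R * c] is at most 1/2 in [mean_value_le]; the successor keeps [c] positive
   when [m] is 0. *)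
pose c : R := (2 * m.+1%:R)^-1.
have c0 : 0 < c by rewrite invr_gt0 mulr_gt0.
pose p x := f x - x.
have dp x : U x -> differentiable p x by move=> Ux; exact: differentiableB (df _ Ux) _.
have Dp x v : U x -> 'D_v p x = 'D_v f x - v.
  move=> Ux; rewrite deriveB ?derive_id //.
  by apply: diff_derivable; exact: df.
have mc : m%:R * c <= 2^-1.
  rewrite /c invfM mulrC -mulrA ger_pMr ?invr_gt0 // ler_pdivrMl // mulr1.
  by rewrite ler_nat.
have [r r0 rU] : exists2 r : R, 0 < r & forall x : 'rV[R]_m, ball a r x ->
    U x /\ forall i j, `|'D_(delta_mx 0 j) (fun y => p y 0 i) x| <= c.
  have : \forall x \near a, U x /\
      forall ij : 'I_m * 'I_m, `|'D_(delta_mx 0 ij.2) (fun y => p y 0 ij.1) x| <= c.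
    near=> x; have Ux : U x by near: x; exact: open_nbhs_nbhs.
    split=> //; near: x; apply: filter_forall => -[i j] /=.
    have : {for a, continuous ('D_(delta_mx 0 j) f)}.
      apply: (@Ck_on_continuous _ 0 _ _ U) => //; exact: (sf 1%N).2.
    move=> /cvgrPdist_le/(_ c c0); have : nbhs a U by exact: open_nbhs_nbhs.
    apply: filterS2 => x Ux /=; rewrite fa => H.
    rewrite -derive_entry ?Dp; [|by []|exact: dp].
    apply: le_trans H; rewrite distrC; exact: norm_entry_le.
  move=> /nbhs_ballP [r /= r0 H]; exists r => // x /H [Ux Hx].
  by split=> // i j; exact: (Hx (i, j)).
have plip (x y : 'rV[R]_m) : ball a r x -> ball a r y ->
    `|p x - p y| <= 2^-1 * `|x - y|.
  move=> ax ay; apply: mx_norm_le => [|i j]; first by rewrite mulr_ge0 ?invr_ge0.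
  have -> : (p x - p y) i j = p x 0 j - p y 0 j by rewrite ord1 !mxE.
  have := @mean_value_le m (fun z => p z 0 j) a r c.
  move=> H; apply: le_trans (H _ _ x y ax ay) _ => //.
  - by move=> z /rU [Uz _]; apply: differentiable_entry; exact: dp.
  - by move=> z l /rU [_]; exact.
  - by rewrite ler_wpM2r.
have flip (x y : 'rV[R]_m) : ball a r x -> ball a r y -> `|x - y| <= 2 * `|f x - f y|.
  move=> ax ay; have := plip _ _ ax ay.
  have -> : p x - p y = (f x - f y) - (x - y).
    by apply/matrixP => i j; rewrite !mxE; ring.
  move=> H; have := lerB_normD (x - y) (f x - f y - (x - y)).
  rewrite [X in _ <= `|X|]addrC subrK => H'.
  have : `|x - y| - 2^-1 * `|x - y| <= `|f x - f y|.
    by apply: le_trans H'; rewrite lerB.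
  lra.
have finj (x y : 'rV[R]_m) : ball a r x -> ball a r y -> f x = f y -> x = y.
  move=> ax ay fxy; have := flip _ _ ax ay; rewrite fxy subrr normr0 mulr0.
  by rewrite normr_le0 subr_eq0 => /eqP.
pose V := ball a r : set 'rV[R]_m.
have VU : V `<=` U by move=> x /rU [].
have oV : open V by exact: ball_open.
have ofV : open (f @` V).
  rewrite openE => _ [x0 Vx0 <-].
  have /nbhs_ballP [e /= e0 eV] : nbhs x0 V by exact: open_nbhs_nbhs.
  pose d := e / 2; have d0 : 0 < d by rewrite divr_gt0.
  have dV x : `|x - x0| <= d -> V x.
    move=> xd; apply: eV; rewrite -ball_normE /= distrC; apply: le_lt_trans xd _.
    by rewrite /d ltr_pdivrMr // ltr_pMr // ltr1n.
  (* A fixed point of x |-> y - p x solves f x = y. This map preserves the closed ball of radius [d]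
     around [x0]: the perturbation contributes at most d/2, which leaves d/2 for the distance from y
     to f x0. *)
  apply/nbhs_ballP; exists (d / 2); first by rewrite /= divr_gt0.
  move=> y; rewrite -ball_normE /= => yd.
  have [||||x xd xE] := @contraction_fixpoint m (fun x => y - p x) x0 d 2^-1.
  - exact: ltW.
  - by rewrite invf_lt1 // ltr1n.
  - move=> x xd.
    have -> : y - p x - x0 = (p x0 - p x) - (f x0 - y).
      by apply/matrixP => i j; rewrite !mxE; ring.
    apply: le_trans (ler_normB _ _) _.
    have := plip _ _ Vx0 (dV _ xd); rewrite (distrC x0); lra.
  - move=> x x' xd xd'.
    have -> : y - p x - (y - p x') = p x' - p x.
      by apply/matrixP => i j; rewrite !mxE; ring.
    by rewrite (distrC x); apply: plip; exact: dV.
  - exists x; first exact: dV.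
    by move/eqP: xE; rewrite subr_eq /p addrC subrK => /eqP.
pose g y := xget a [set x | V x /\ f x = y].
have gf x : V x -> g (f x) = x.
  move=> Vx; rewrite /g; case: xgetP => [z -> [Vz fz]|/(_ x) []//].
  exact: finj.
have Vg y : (f @` V) y -> V (g y) by move=> [x Vx <-]; rewrite gf.
have fg y : (f @` V) y -> f (g y) = y by move=> [x Vx <-]; rewrite gf.
pose J x := jacobian f x.
have JE x v : V x -> v *m J x = 'D_v f x.
  by move=> Vx; rewrite deriveEjacobian //; apply: df; exact: VU.
(* If [v] is killed by the Jacobian then ['D_v p x = - v], while the bound on the partial
   derivatives gives norm at most half that of [v]; hence [v] is 0. *)
have Ju x : V x -> J x \in unitmx.
  move=> Vx; rewrite -row_free_unit; apply/inj_row_free => v.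
  rewrite JE // => vJ; apply/eqP; rewrite -normr_le0.
  have : `|v| <= 2^-1 * `|v|.
    have Dv : 'D_v p x = - v by rewrite Dp ?vJ ?sub0r //; exact: VU.
    rewrite -[leLHS]normrN -Dv.
    have dpx := dp _ (VU _ Vx).
    apply: mx_norm_le => [|i j]; first by rewrite mulr_ge0 ?invr_ge0.
    rewrite ord1 derive_entry // derive_rV_sum; last exact: differentiable_entry.
    apply: le_trans (ler_norm_sum _ _ _) _.
    apply: le_trans (_ : \sum_(l < m) c * `|v| <= _); last first.
      by rewrite sumr_const card_ord -[leLHS]mulr_natl mulrA ler_wpM2r.
    apply: ler_sum => l _; rewrite normrZ mulrC.
    by rewrite ler_pM // ?norm_entry_le //; exact: (rU _ Vx).2.
  have := normr_ge0 v; lra.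
have dg y : (f @` V) y -> differentiable g y /\
    'd g y = mulmxr (invmx (J (g y))) :> ('rV[R]_m -> 'rV[R]_m).
  move=> fVy; set x := g y; have Vx : V x := Vg _ fVy.
  have fx : f x = y by exact: fg.
  apply: differentiable_eps; first exact: continuous_mulmxr.
  move=> e e0.
  pose L : {linear 'rV[R]_m -> 'rV[R]_m} := mulmxr (invmx (J x)).
  have Lc : continuous L by exact: continuous_mulmxr.
  have [C C0 HC] := linear_lipschitz Lc.
  (* [C] is a Lipschitz constant of the inverse derivative and 2 that of [g], by [flip]; with this
     tolerance the final error is e times the norm of h. The same 2 accounts for the radius d/2
     below. *)
  have e'0 : 0 < e / (2 * C) by rewrite divr_gt0 // mulr_gt0.
  have /eqaddoP /(_ _ e'0) := diff_locally (df _ (VU _ Vx)).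
  move=> /nbhs_ballP [d /= d0 Hd].
  have : nbhs y (f @` V) by exact: open_nbhs_nbhs.
  move=> /nbhs_ballP [d' /= d'0 Hd'].
  apply/nbhs_ballP; exists (Num.min d' (d / 2)).
    by rewrite /= lt_min d'0 divr_gt0.
  move=> h; rewrite -ball_normE /= sub0r normrN lt_min => /andP[hd' hd].
  have fVhy : (f @` V) (h + y).
    by apply: Hd'; rewrite -ball_normE /= opprD addrCA subrr addr0 normrN.
  set x' := g (h + y); have Vx' : V x' := Vg _ fVhy.
  have fx' : f x' = h + y by exact: fg.
  have lipx : `|x' - x| <= 2 * `|h|.
    by have := flip _ _ Vx' Vx; rewrite fx fx' addrK.
  have := Hd (x' - x); rewrite -ball_normE /= sub0r normrN => H.
  have {}H : `|f x' - f x - (x' - x) *m J x| <= e / (2 * C) * `|x' - x|.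
    have {H} := H (_ : _ < d).
    rewrite !fctE /= subrK opprD addrA JE // deriveE; last by apply: df; exact: VU.
    apply; lra.
  have -> : x' - x - h *m invmx (J x) = - L (f x' - f x - (x' - x) *m J x).
    rewrite /= fx fx' addrK [in RHS]mulmxBl -mulmxA mulmxV ?Ju // mulmx1.
    by rewrite opprB.
  rewrite normrN; apply: le_trans (HC _) _.
  apply: le_trans (ler_wpM2l (ltW C0) H) _.
  apply: le_trans (ler_wpM2l (ltW C0) (ler_wpM2l (ltW e'0) lipx)) _.
  rewrite le_eqVlt; apply/orP; left; apply/eqP; field.
  by rewrite gt_eqF.
exists V, g; split => //; first exact: ballxx.
split=> //; elim=> [|k IH].
  apply/Ck_on0P => y fVy; apply: differentiable_continuous; exact: (dg _ fVy).1.
split=> [y fVy|v]; first exact: (dg _ fVy).1.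
(* Bootstrap: the derivative of [g] at y is multiplication by the inverse of [J (g y)], which is of
   class C^k as soon as [g] is. *)
have CJ : Ck_on k V J.
  apply: Ck_on_mx => // i j.
  apply: eq_Ck_on (Ck_on_entry 0 j oV (Ck_on_subset VU ((sf k.+1).2 (delta_mx 0 i)))) => //.
  by move=> x Vx; rewrite -JE // -rowE mxE.
have Ci := Ck_on_invmx ofV (fun y fVy => Ju _ (Vg _ fVy)) (Ck_on_comp_mx ofV oV Vg IH CJ).
apply: eq_Ck_on (Ck_on_mulmx ofV (Ck_on_cst k (f @` V) v) Ci) => // y fVy.
by have [dgy gE] := dg _ fVy; rewrite deriveE // gE.
Unshelve. all: by end_near. Qed.

Theorem inverse_function m (U : set 'rV[R]_m) (f : 'rV[R]_m -> 'rV[R]_m) a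
    (J : 'M[R]_m) :
  open U -> U a -> smooth_on U f -> J \in unitmx -> (forall v, 'D_v f a = v *m J) ->
  exists V, exists g : 'rV[R]_m -> 'rV[R]_m,
    [/\ open V, V `<=` U, V a, open (f @` V) &
        (forall x, V x -> g (f x) = x) /\ smooth_on (f @` V) g].
Proof.
move=> oU Ua sf Ju fJ.
pose f1 x := f x *m invmx J.
have sf1 : smooth_on U f1 by move=> k; apply: Ck_on_mulmxr => //; exact: sf.
have f1a v : 'D_v f1 a = v.
  have df : differentiable f a by exact: (sf 1%N).1.
  pose L : {linear 'rV[R]_m -> 'rV[R]_m} := mulmxr (invmx J).
  have Lc : continuous L by exact: continuous_mulmxr.
  rewrite (_ : f1 = L \o f) // derive_comp_rV //; last exact: linear_differentiable.
  rewrite deriveE; last exact: linear_differentiable.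
  by rewrite (diff_lin _ Lc) /= fJ mulmxK.
have [V [g [oV VU Va of1V [gf sg]]]] := inverse_function_id oU Ua sf1 f1a.
have imE : f @` V = (mulmxr (invmx J)) @^-1` (f1 @` V).
  apply/seteqP; split=> [_ [x Vx <-]|y [x Vx /= xy]]; first by exists x.
  by exists x => //; rewrite -[RHS](mulmxKV Ju) -xy mulmxKV.
have ofV : open (f @` V).
  rewrite imE; apply: open_comp => // x _; exact: continuous_mulmxr.
exists V, (fun y => g (y *m invmx J)); split=> //; split; first exact: gf.
move=> k; apply: (Ck_on_comp_mx (U' := f1 @` V)) => //.
- by move=> x; rewrite imE.
- by apply: (@Ck_on_linear _ k _ _ _ (mulmxr (invmx J))); exact: continuous_mulmxr.
Qed.

Lemma ball_row_mx d (t0 t : 'rV[R]_d) (a0 a r : R) :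
  ball (row_mx t0 a0%:M : 'rV[R]_(d + 1)) r (row_mx t a%:M) <->
  ball t0 r t /\ ball a0 r a.
Proof.
rewrite -!ball_normE /= opp_row_mx add_row_mx; set p := row_mx _ _.
have pr j : p 0 (rshift d j) = a0 - a by rewrite row_mxEr !ord1 !mxE eqxx !mulr1n.
split=> [pr0|[tr ar]].
  split; last by apply: le_lt_trans pr0; rewrite -(pr 0) norm_entry_le.
  apply: le_lt_trans pr0; apply: mx_norm_le => // i j.
  by rewrite ord1 -(row_mxEl (t0 - t) (a0%:M - a%:M)) norm_entry_le.
apply: (@le_lt_trans _ _ (Num.max `|t0 - t| `|a0 - a|)); last by rewrite gt_max tr ar.
apply: mx_norm_le => [|i j]; first by rewrite le_max normr_ge0.
rewrite ord1 le_max; case: (split_ordP j) => j' ->; last by rewrite pr lexx orbT.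
by rewrite row_mxEl norm_entry_le.
Qed.

Lemma Ck_on_graph d k (T : set 'rV[R]_d) (l : 'rV[R]_d -> R) : open T ->
  Ck_on k T l -> Ck_on k T (fun t => row_mx t (l t)%:M : 'rV[R]_(d + 1)).
Proof.
move=> oT Cl; apply: Ck_on_mx => // i j; rewrite ord1.
case: (split_ordP j) => j' ->.
  under eq_fun do rewrite row_mxEl.
  apply: (Ck_on_entry (f := id)) => //.
  by apply: (@Ck_on_linear _ _ _ _ _ idfun) => t.
by under eq_fun do rewrite row_mxEr ord1 mxE eqxx mulr1n.
Qed.

Lemma derive_graph d (l : 'rV[R]_d -> R) t v : differentiable l t ->
  'D_v (fun t => row_mx t (l t)%:M : 'rV[R]_(d + 1)) t = row_mx v ('D_v l t)%:M.
Proof.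
move=> dl.
have E j : (fun t => (row_mx t (l t)%:M : 'rV[R]_(d + 1)) 0 (rshift d j)) = l.
  by apply/funext => s; rewrite row_mxEr ord1 mxE eqxx mulr1n.
have E' j : (fun t => (row_mx t (l t)%:M : 'rV[R]_(d + 1)) 0 (lshift 1 j)) =
    fun t : 'rV[R]_d => t 0 j.
  by apply/funext => s; rewrite row_mxEl.
have dg : differentiable (fun t => row_mx t (l t)%:M : 'rV[R]_(d + 1)) t.
  apply: differentiable_mx => i j; rewrite ord1; case: (split_ordP j) => j' ->.
    by rewrite E'; exact: differentiable_coord.
  by rewrite E.
apply/matrixP => i j; rewrite ord1 derive_entry //; case: (split_ordP j) => j' ->.
  by rewrite E' row_mxEl -(derive_entry (f := id)) // derive_id.
by rewrite E row_mxEr ord1 mxE eqxx mulr1n.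
Qed.

(** The inverse function theorem is applied to (t, a) |-> (t, h(t, a)), and [l t] is the last
    coordinate of the preimage of (t, 0). The uniqueness radius [e] is uniform in [t]; it serves
    later to recognize an eigenvalue as [l t]. *)
Theorem implicit_function_scalar d (O : set 'rV[R]_(d + 1)) (h : 'rV[R]_(d + 1) -> R)
    (t0 : 'rV[R]_d) (l0 : R) :
  open O -> O (row_mx t0 l0%:M) -> smooth_on O h -> h (row_mx t0 l0%:M) = 0 ->
  'D_(row_mx 0 1%:M) h (row_mx t0 l0%:M) != 0 ->
  exists T : set 'rV[R]_d, exists l : 'rV[R]_d -> R, exists e : R,
    [/\ open T, T t0, smooth_on T l, l t0 = l0 &
      0 < e /\ forall t, T t ->
        [/\ O (row_mx t (l t)%:M), h (row_mx t (l t)%:M) = 0 &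
         forall x, `|x - l0| < e -> h (row_mx t x%:M) = 0 -> x = l t]].
Proof.
set p0 := row_mx t0 l0%:M => oO Op0 sh hp0 hd.
have dh : differentiable h p0 by exact: (sh 1%N).1.
pose w : 'rV[R]_(d + 1) := row_mx 0 1%:M.
pose A : 'M[R]_(d + 1) := col_mx 1%:M 0 *m row_mx 1%:M 0.
have vA (v : 'rV[R]_(d + 1)) : v *m A = row_mx (lsubmx v) 0.
  rewrite /A mulmxA -[in LHS](hsubmxK v) mul_row_col mulmx1 mulmx0 addr0.
  by rewrite mul_mx_row mulmx1 mulmx0.
pose f p := p *m A + h p *: w.
have fE p : f p = row_mx (lsubmx p) (h p)%:M.
  by rewrite /f vA scale_row_mx scaler0 add_row_mx addr0 add0r scalemx1.
pose K : 'cV[R]_(d + 1) := \col_i 'D_(delta_mx 0 i) h p0.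
have vK v : v *m K = ('D_v h p0)%:M.
  apply/matrixP => i j; rewrite !ord1 !mxE eqxx mulr1n derive_rV_sum //.
  by apply: eq_bigr => l _; rewrite !mxE.
pose J := A + K *m w.
have sf : smooth_on O f.
  move=> k; apply: Ck_onD => //.
    by apply: (@Ck_on_linear _ k _ _ _ (mulmxr A)); exact: continuous_mulmxr.
  apply: Ck_on_mx => // i j; under eq_fun do rewrite mxE.
  by apply: Ck_onM => //; exact: Ck_on_cst.
have fJ v : 'D_v f p0 = v *m J.
  have LAc : continuous (mulmxr A : 'rV[R]_(d + 1) -> 'rV[R]_(d + 1)).
    exact: continuous_mulmxr.
  have dhw : differentiable (fun p => h p *: w) p0 by exact: differentiableZl.
  have dA : differentiable (fun p => p *m A) p0.
    exact: (@linear_differentiable _ _ _ (mulmxr A)).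
  rewrite deriveD; [|exact: diff_derivable|exact: diff_derivable].
  rewrite [X in X + _]deriveE // (@diff_lin _ _ _ (mulmxr A)) //=.
  rewrite deriveE // diffZl // -deriveE // mulmxDr (mulmxA v K) vK.
  by rewrite mul_scalar_mx.
have Ju : J \in unitmx.
  rewrite -row_free_unit; apply/inj_row_free => v.
  rewrite mulmxDr vA (mulmxA v K) vK mul_scalar_mx scale_row_mx scaler0 add_row_mx addr0 add0r.
  rewrite -row_mx0 => /eq_row_mx [lv0].
  have [c ->] : exists c, v = c *: w.
    by exists ((rsubmx v) 0 0); rewrite -{1}(hsubmxK v) lv0 scale_row_mx scaler0 scalemx1 -mx11_scalar.
  rewrite deriveE // linearZ -deriveE //=.
  move/matrixP/(_ 0 0); rewrite !mxE eqxx mulr1n => /eqP.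
  by rewrite mulr1 mulf_eq0 (negbTE (hd : 'D_w h p0 != 0)) orbF => /eqP ->; rewrite scale0r row_mx0.
have [V [g [oV VO Vp0 ofV [gf sg]]]] := inverse_function oO Op0 sf Ju fJ.
pose emb (t : 'rV[R]_d) : 'rV[R]_(d + 1) := t *m row_mx 1%:M 0.
have embE t : emb t = row_mx t 0 by rewrite /emb mul_mx_row mulmx1 mulmx0.
have embc : continuous emb by exact: continuous_mulmxr.
have /nbhs_ballP [r /= r0 rV] : nbhs p0 V by exact: open_nbhs_nbhs.
(* In the sup norm, restricting [t] to this ball puts (t, x) in [V] whenever x is within [r] of
   [l0]; this gives uniqueness with [e] equal to [r]. *)
pose T := ball t0 r `&` emb @^-1` (f @` V).
have oT : open T.
  by apply: openI; [exact: ball_open|apply: open_comp => // x _; exact: embc].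
pose l t := g (emb t) 0 (rshift d 0).
have gE t : T t -> g (emb t) = row_mx t (l t)%:M /\ (V (g (emb t)) /\ h (g (emb t)) = 0).
  move=> [_ /= [p Vp fp]]; have gp : g (emb t) = p by rewrite -fp gf.
  rewrite embE fE in fp; have [lp hp] := eq_row_mx fp.
  rewrite /l gp; split; last first.
    by split=> //; move/matrixP/(_ 0 0): hp; rewrite !mxE eqxx mulr1n.
  rewrite -[LHS]hsubmxK lp; congr row_mx.
  by rewrite [LHS]mx11_scalar mxE.
have Tt0 : T t0.
  split; first exact: ballxx.
  by exists p0 => //; rewrite fE row_mxKl hp0 embE raddf0.
exists T, l, r; split => //.
- move=> k; apply: Ck_on_entry => //.
  apply: (Ck_on_comp_mx (U' := f @` V)) => //; first by move=> t [].
  by apply: (@Ck_on_linear _ k _ _ _ (mulmxr (row_mx 1%:M 0))); exact: continuous_mulmxr.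
- rewrite /l; have -> : emb t0 = f p0 by rewrite fE row_mxKl hp0 embE raddf0.
  by rewrite gf // /p0 row_mxEr mxE eqxx mulr1n.
split=> // t Tt; have [gtE [Vg hg]] := gE _ Tt; rewrite -gtE; split=> //.
  exact: VO.
move=> x xl hx; have Vx : V (row_mx t x%:M).
  apply: rV; apply/ball_row_mx; split; first by case: Tt.
  by rewrite -ball_normE /= distrC.
have : g (f (row_mx t x%:M)) = row_mx t (l t)%:M by rewrite fE row_mxKl hx raddf0 -embE.
rewrite gf // => /eq_row_mx [_ /matrixP/(_ 0 0)].
by rewrite !mxE eqxx !mulr1n.
Qed.

End InverseFunction.

(** * Perturbation of eigenvalues of Hermitian matrices *)

Section Spectrum.
Local Open Scope sesquilinear_scope.
Local Open Scope complex_scope.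
Context {R : realType}.
Local Notation C := R[i].

Lemma char_poly_conj (F : fieldType) n (P A : 'M[F]_n) :
  P \in unitmx -> char_poly (invmx P *m A *m P) = char_poly A.
Proof.
move=> Pu; rewrite /char_poly.
have -> : char_poly_mx (invmx P *m A *m P) =
    map_mx polyC (invmx P) *m char_poly_mx A *m map_mx polyC P.
  rewrite /char_poly_mx mulmxBr mulmxBl -!map_mxM; congr (_ - _).
  by rewrite scalar_mxC -mulmxA -map_mxM mulVmx // map_mx1 mulmx1.
by rewrite !det_mulmx mulrAC -det_mulmx -map_mxM mulVmx // map_mx1 det1 mul1r.
Qed.

Lemma char_poly_diag (F : fieldType) n (D : 'rV[F]_n) :
  char_poly (diag_mx D) = \prod_(i < n) ('X - (D 0 i)%:P).
Proof.
rewrite char_poly_trig; last exact: diag_mx_is_trig.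
by apply: eq_bigr => i _; rewrite mxE eqxx mulr1n.
Qed.

Definition rdiag n (s : seq R) : 'M[C]_n := diag_mx (\row_i (s`_i)%:C).

Lemma hermitian_diagonal n (X : 'M[C]_n) :
  X^t* = X -> exists2 s : seq R, size s = n &
  exists2 Q : 'M[C]_n, Q \is unitarymx & X = Q^t* *m rdiag n s *m Q.
Proof.
move=> Xh.
have Xhs : X \is hermsymmx by apply/is_hermitianmxP; rewrite expr0 scale1r Xh.
have [Q [D [Qu XE Dr]]] : exists Q, exists D : 'rV[C]_n,
    [/\ Q \is unitarymx, X = invmx Q *m diag_mx D *m Q & D \is a realmx].
  exists (spectralmx X), (spectral_diag X); split.
  - exact: spectral_unitarymx.
  - exact/orthomx_spectralP/hermitian_normalmx.
  - exact: hermitian_spectral_diag_real.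
exists [seq complex.Re (D 0 i) | i <- enum 'I_n].
  by rewrite size_map size_enum_ord.
exists Q => //.
suff DE : D = \row_i ([seq complex.Re (D 0 i) | i <- enum 'I_n]`_i)%:C.
  by rewrite /rdiag -DE -invmx_unitary.
apply/rowP => i; rewrite mxE (nth_map i) ?size_enum_ord // nth_ord_enum.
by rewrite RRe_real //; move/mxOverP: Dr.
Qed.

Lemma char_poly_rdiag n (s : seq R) (Q : 'M[C]_n) :
  size s = n -> Q \is unitarymx ->
  char_poly (Q^t* *m rdiag n s *m Q) = \prod_(a <- s) ('X - (a%:C)%:P).
Proof.
move=> sn Qu; rewrite -invmx_unitary // char_poly_conj; last exact: unitarymx_unit.
rewrite char_poly_diag (big_nth 0) sn big_mkord.
by apply: eq_bigr => i _; rewrite mxE.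
Qed.

(** The characteristic polynomial fixes the eigenvalues up to order, and permuting the rows of the
    unitary matrix realizes any order. This links [eigvals], which is specified by that polynomial
    and sortedness, to a diagonalization. *)
Lemma hermitian_diagonal_perm n (X : 'M[C]_n) (s : seq R) :
  X^t* = X -> char_poly X = \prod_(a <- s) ('X - (a%:C)%:P) ->
  size s = n /\ exists2 Q : 'M[C]_n, Q \is unitarymx & X = Q^t* *m rdiag n s *m Q.
Proof.
move=> Xh Xs; have [t tn [P Pu XE]] := hermitian_diagonal Xh.
have : perm_eq (map (real_complex R) s) (map (real_complex R) t).
  by apply: prod_XsubC_eq; rewrite !big_map -Xs XE char_poly_rdiag.
move=> /(perm_map_inj (@complexI R)) st.
have sn : size s = n by rewrite (perm_size st).
have /tuple_permP [p sE] : perm_eq s (Tuple (introT eqP tn)) by exact: st.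
split=> //; exists (row_perm p P).
  apply/unitarymxP; rewrite row_permE trmx_mul map_mxM /= -mulmxA (mulmxA P).
  rewrite (unitarymxP Pu) mul1mx tr_perm_mx map_perm_mx.
  by rewrite -perm_mxM mulgV perm_mx1.
rewrite row_permE trmx_mul map_mxM /= tr_perm_mx map_perm_mx.
rewrite XE -!mulmxA; congr (_ *m _); rewrite !mulmxA; congr (_ *m _).
have -> : perm_mx p = perm_mx (p^-1)^-1%g :> 'M[C]_n by rewrite invgK.
rewrite -row_permE -col_permE; apply/matrixP => i j; rewrite !mxE.
rewrite (inj_eq perm_inj); congr (_ *+ _).
by rewrite sE -tnth_nth tnth_mktuple permKV (tnth_nth 0).
Qed.

Definition qform n (X : 'M[C]_n) (v : 'rV[C]_n) : C := (v *m X *m v^t*) 0 0.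

Lemma qform1 n (v : 'rV[C]_n) : qform 1%:M v = \sum_i `|v 0 i| ^+ 2.
Proof.
rewrite /qform mulmx1 mxE; apply: eq_bigr => i _.
by rewrite !mxE normCK.
Qed.

Lemma qform1_gt0 n (v : 'rV[C]_n) : v != 0 -> 0 < qform 1%:M v.
Proof.
move=> v0; rewrite qform1 lt_def sumr_ge0 ?andbT; last by move=> i _; exact: exprn_ge0.
apply: contra v0; rewrite psumr_eq0 => [/allP H|i _]; last exact: exprn_ge0.
apply/eqP/rowP => i; rewrite mxE; apply/eqP.
by have := H i (mem_index_enum _); rewrite sqrf_eq0 normr_eq0.
Qed.

Lemma qform_diagonal n (s : seq R) (Q : 'M[C]_n) v :
  qform (Q^t* *m rdiag n s *m Q) v = \sum_(i < n) (s`_i)%:C * `|(v *m Q^t*) 0 i| ^+ 2.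
Proof.
rewrite /qform; set a := v *m Q^t*.
have -> : v *m (Q^t* *m rdiag n s *m Q) *m v^t* = a *m rdiag n s *m a^t*.
  by rewrite /a trmx_mul map_mxM /= trmxCK !mulmxA.
move: a => a; rewrite mxE; apply: eq_bigr => i _; rewrite mul_mx_diag !mxE normCK.
by rewrite (mulrC (a 0 i)) mulrA.
Qed.

(** The order of [R[i]] compares only numbers with equal imaginary parts, so a difference of forms
    must be known to be real before it is bounded by its modulus. *)
Lemma qform_diagonal_real n (s : seq R) (Q : 'M[C]_n) v :
  qform (Q^t* *m rdiag n s *m Q) v \is Num.real.
Proof.
rewrite qform_diagonal; apply: rpred_sum => i _; apply: rpredM; last first.
  by apply: ger0_real; exact: exprn_ge0.
by rewrite complex_real.
Qed.

Lemma qform1_unitary n (Q : 'M[C]_n) v : Q \is unitarymx ->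
  qform 1%:M (v *m Q^t*) = qform 1%:M v.
Proof.
move=> Qu; rewrite /qform !mulmx1 trmx_mul map_mxM /= trmxCK mulmxA.
by rewrite mulmxKtV.
Qed.

Lemma qformB n (X Y : 'M[C]_n) v : qform X v - qform Y v = qform (X - Y) v.
Proof. by rewrite /qform mulmxBr mulmxBl !mxE. Qed.

(** Each of the n^2 terms is estimated crudely, a product of two moduli being at most the squared
    norm of [v]. Only continuity of the eigenvalues is drawn from this, so the constant is
    immaterial. *)
Lemma qform_le n (E : 'M[C]_n) (e : C) v :
  (forall i j, `|E i j| <= e) -> `|qform E v| <= n%:R ^+ 2 * e * qform 1%:M v.
Proof.
move=> Ee; rewrite qform1; set N := \sum_i _.
have Nle i : `|v 0 i| ^+ 2 <= N.
  rewrite /N (bigD1 i) //= lerDl sumr_ge0 // => j _; exact: exprn_ge0.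
have vv i j : `|v 0 i| * `|v 0 j| <= N.
  have [ij|ij] := real_leP (normr_real (v 0 i)) (normr_real (v 0 j)).
    by apply: le_trans (Nle j); rewrite expr2 ler_wpM2r.
  by apply: le_trans (Nle i); rewrite expr2 ler_wpM2l // ltW.
have -> : qform E v = \sum_i \sum_j v 0 j * E j i * (v 0 i)^*%R.
  rewrite /qform mxE; apply: eq_bigr => i _; rewrite !mxE mulr_suml.
  by apply: eq_bigr => j _.
apply: le_trans (ler_norm_sum _ _ _) _.
apply: le_trans (_ : \sum_(i < n) \sum_(j < n) e * N <= _).
  apply: ler_sum => i _; apply: le_trans (ler_norm_sum _ _ _) _.
  apply: ler_sum => j _; rewrite !normrM norm_conjC mulrAC mulrC.
  by rewrite ler_pM // mulr_ge0.
by rewrite !sumr_const !card_ord -!mulrnA -[leLHS]mulr_natl natrM expr2 !mulrA.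
Qed.

Lemma sorted_nth_le (s : seq R) i j :
  sorted <=%R s -> (i <= j)%N -> (j < size s)%N -> s`_i <= s`_j.
Proof.
move=> ss ij js; apply: (sorted_leq_nth le_trans le_refl) => //; rewrite inE //.
exact: leq_ltn_trans js.
Qed.

(** The rows of [Q] of index at least [k] span dimension n - k, those of [P] of index at most [k]
    span k + 1, as indices start at 0; the sum exceeds n, so the spans meet. *)
Lemma flag_vector (F : fieldType) n (Q P : 'M[F]_n) (k : 'I_n) :
  Q \in unitmx -> P \in unitmx ->
  exists2 v : 'rV[F]_n, v != 0 &
    forall i : 'I_n, ((i < k)%N -> (v *m invmx Q) 0 i = 0) /\
                     ((k < i)%N -> (v *m invmx P) 0 i = 0).
Proof.
move=> Qu Pu; pose V := copid_mx k *m Q; pose W : 'M[F]_n := pid_mx k.+1 *m P.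
have rV : \rank V = (n - k)%N.
  by rewrite mxrankMfree ?rank_copid_mx ?row_free_unit // ltnW.
have rW : \rank W = k.+1 by rewrite mxrankMfree ?rank_pid_mx ?row_free_unit.
have cap0 : (V :&: W)%MS != 0.
  rewrite -mxrank_eq0 -lt0n; have := mxrank_sum_cap V W; rewrite rV rW.
  have := rank_leq_col (V + W)%MS; have := ltn_ord k; lia.
exists (nz_row (V :&: W)%MS); first by rewrite nz_row_eq0.
have : (nz_row (V :&: W)%MS <= V :&: W)%MS by exact: nz_row_sub.
rewrite sub_capmx => /andP[/submxP[w wV] /submxP[w' w'W]] i; split=> ik.
  rewrite wV mulmxA mulmxK // mxE big1 // => j _.
  by rewrite !mxE -val_eqE /=; case: eqP => [->|_]; rewrite ?ik subrr mulr0.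
rewrite w'W mulmxA mulmxK // mxE big1 // => j _.
by rewrite mxE; case: eqP => [->|]; rewrite ?mulr0 // ltnNge ik mulr0.
Qed.

(* Dimension count: some v <> 0 lies in the span of the eigenvectors of X of
   index >= k and in that of the eigenvectors of Y of index <= k. *)
Lemma eigenvalue_perturbation n (X Y : 'M[C]_n) (s r : seq R) (Q P : 'M[C]_n) (e : R)
    (k : 'I_n) :
  size s = n -> size r = n -> sorted <=%R s -> sorted <=%R r ->
  Q \is unitarymx -> P \is unitarymx ->
  X = Q^t* *m rdiag n s *m Q -> Y = P^t* *m rdiag n r *m P ->
  (forall i j, `|X i j - Y i j| <= e%:C) ->
  s`_k <= r`_k + n%:R ^+ 2 * e.
Proof.
move=> sn rn ss rs Qu Pu XE YE XY.
have [v v0 vQP] := flag_vector k (unitarymx_unit Qu) (unitarymx_unit Pu).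
rewrite (invmx_unitary Qu) (invmx_unitary Pu) in vQP.
have N0 := qform1_gt0 v0; set N := qform 1%:M v in N0.
have NX : (s`_k)%:C * N <= qform X v.
  rewrite XE qform_diagonal /N -(qform1_unitary v Qu) qform1 mulr_sumr.
  apply: ler_sum => i _; have [ik|ki] := ltnP i k.
    by rewrite (vQP i).1 // normr0 expr0n !mulr0.
  by rewrite ler_wpM2r ?exprn_ge0 // lecR sorted_nth_le ?sn.
have NY : qform Y v <= (r`_k)%:C * N.
  rewrite YE qform_diagonal /N -(qform1_unitary v Pu) qform1 mulr_sumr.
  apply: ler_sum => i _; have [ik|ki] := leqP i k.
    by rewrite ler_wpM2r ?exprn_ge0 // lecR sorted_nth_le ?rn.
  by rewrite (vQP i).2 // normr0 expr0n !mulr0.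
have NE : qform X v - qform Y v <= (n%:R ^+ 2 * e)%:C * N.
  have XYr : qform X v - qform Y v \is Num.real.
    by rewrite XE YE; apply: rpredB; exact: qform_diagonal_real.
  apply: le_trans (real_ler_norm XYr) _; rewrite qformB.
  rewrite (_ : (_ * _)%:C = n%:R ^+ 2 * e%:C); last by rewrite rmorphM rmorphXn /= rmorph_nat.
  by apply: qform_le => i j; rewrite !mxE.
rewrite -lecR -(ler_pM2r N0) rmorphD mulrDl.
apply: le_trans NX _; rewrite -lerBlDl; apply: le_trans NE; by rewrite lerD2l lerN2.
Qed.

End Spectrum.

(** * Real and complex scalars under one notation *)

Section BaseField.
Context {R : realType} {b : base_field}.
Local Notation K := (rc_scalar R b).
Implicit Types z w : K.

(** Identities over the base field are reduced to real ones in this way, which mostly confines the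
    case distinction on [b] to the rules for [rc_re] and [rc_im]. *)
Lemma rc_eqP z w : rc_re z = rc_re w -> rc_im z = rc_im w -> z = w.
Proof. by case: b z w => //= -[x y] [x' y'] /= -> ->. Qed.

Lemma rc_reD z w : rc_re (z + w) = rc_re z + rc_re w.
Proof. by case: b z w => //= -[x y] [x' y']. Qed.
Lemma rc_imD z w : rc_im (z + w) = rc_im z + rc_im w.
Proof. by case: b z w => /= [z w|[x y] [x' y']] //; rewrite addr0. Qed.
Lemma rc_reM z w : rc_re (z * w) = rc_re z * rc_re w - rc_im z * rc_im w.
Proof. by case: b z w => /= [z w|[x y] [x' y']] //; rewrite mul0r subr0. Qed.
Lemma rc_imM z w : rc_im (z * w) = rc_re z * rc_im w + rc_im z * rc_re w.
Proof. by case: b z w => /= [z w|[x y] [x' y']] //; rewrite mulr0 mul0r addr0. Qed.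
Lemma rc_reN z : rc_re (- z) = - rc_re z.
Proof. by case: b z => //= -[x y]. Qed.
Lemma rc_imN z : rc_im (- z) = - rc_im z.
Proof. by case: b z => /= [z|[x y]] //; rewrite oppr0. Qed.
Lemma rc_re1 : rc_re (1 : K) = 1. Proof. by case: b. Qed.
Lemma rc_im1 : rc_im (1 : K) = 0. Proof. by case: b. Qed.
Lemma rc_re0 : rc_re (0 : K) = 0. Proof. by case: b. Qed.
Lemma rc_im0 : rc_im (0 : K) = 0. Proof. by case: b. Qed.
Lemma rc_re_real (a : R) : rc_re (rc_of_real a : K) = a. Proof. by case: b. Qed.
Lemma rc_im_real (a : R) : rc_im (rc_of_real a : K) = 0. Proof. by case: b. Qed.
Lemma rc_re_conj z : rc_re (rc_conj z) = rc_re z.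
Proof. by case: b z => //= -[x y]. Qed.
Lemma rc_im_conj z : rc_im (rc_conj z) = - rc_im z.
Proof. by case: b z => /= [z|[x y]] //; rewrite oppr0. Qed.

Definition rc_norm2 z : R := rc_re z ^+ 2 + rc_im z ^+ 2.

Lemma rc_norm2_eq0 z : (rc_norm2 z == 0) = (z == 0).
Proof.
rewrite /rc_norm2 paddr_eq0 ?sqr_ge0 // !sqrf_eq0.
apply/andP/eqP => [[/eqP rz /eqP iz]|->]; last by rewrite rc_re0 rc_im0 eqxx.
by apply: rc_eqP; rewrite ?rc_re0 ?rc_im0.
Qed.

Lemma rc_reV z : rc_re z^-1 = rc_re z / rc_norm2 z.
Proof.
rewrite /rc_norm2; case: b z => /= [z|[x y]] //=.
rewrite expr0n addr0 expr2; have [->|z0] := eqVneq z 0; first by rewrite invr0 mul0r.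
by field.
Qed.

Lemma rc_imV z : rc_im z^-1 = - rc_im z / rc_norm2 z.
Proof.
rewrite /rc_norm2; case: b z => /= [z|[x y]] //=; first by rewrite oppr0 mul0r.
by rewrite mulNr.
Qed.

Lemma rc_of_real_is_zmod : zmod_morphism (rc_of_real : R -> K).
Proof.
by move=> x y; apply: rc_eqP; rewrite ?(rc_reD, rc_imD, rc_reN, rc_imN, rc_re_real, rc_im_real) ?subrr.
Qed.
Lemma rc_of_real_is_monoid : monoid_morphism (rc_of_real : R -> K).
Proof.
split=> [|x y]; apply: rc_eqP;
  rewrite ?(rc_re1, rc_im1, rc_reM, rc_imM, rc_re_real, rc_im_real) //; ring.
Qed.
HB.instance Definition _ := GRing.isZmodMorphism.Build R K (@rc_of_real R b) rc_of_real_is_zmod.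
HB.instance Definition _ := GRing.isMonoidMorphism.Build R K (@rc_of_real R b) rc_of_real_is_monoid.

Lemma rc_conj_is_zmod : zmod_morphism (@rc_conj R b).
Proof.
move=> x y; apply: rc_eqP;
  rewrite ?(rc_reD, rc_imD, rc_reN, rc_imN, rc_re_conj, rc_im_conj) //; ring.
Qed.
Lemma rc_conj_is_monoid : monoid_morphism (@rc_conj R b).
Proof.
split=> [|x y]; apply: rc_eqP;
  rewrite ?(rc_re1, rc_im1, rc_reM, rc_imM, rc_re_conj, rc_im_conj, rc_re1, rc_im1) //; ring.
Qed.
HB.instance Definition _ := GRing.isZmodMorphism.Build K K (@rc_conj R b) rc_conj_is_zmod.
HB.instance Definition _ := GRing.isMonoidMorphism.Build K K (@rc_conj R b) rc_conj_is_monoid.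

Lemma rc_conjK : involutive (@rc_conj R b).
Proof. by move=> z; apply: rc_eqP; rewrite !(rc_re_conj, rc_im_conj) ?opprK. Qed.

Lemma rc_conj_real a : rc_conj (rc_of_real a : K) = rc_of_real a.
Proof. by apply: rc_eqP; rewrite !(rc_re_conj, rc_im_conj, rc_re_real, rc_im_real) ?oppr0. Qed.

(** Being a field morphism, it preserves ranks and commutes with characteristic polynomials;
    conclusions drawn over [R[i]] can thus be read back over the base field. *)
Definition rc_toC z : R[i] := (rc_re z +i* rc_im z)%C.

Lemma rc_toC_is_zmod : zmod_morphism rc_toC.
Proof. by move=> x y; rewrite /rc_toC rc_reD rc_imD rc_reN rc_imN. Qed.
Lemma rc_toC_is_monoid : monoid_morphism rc_toC.
Proof.
split=> [|x y]; first by rewrite /rc_toC rc_re1 rc_im1.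
by rewrite /rc_toC rc_reM rc_imM; congr (_ +i* _)%C; rewrite addrC [X in _ + X]mulrC.
Qed.
HB.instance Definition _ := GRing.isZmodMorphism.Build K R[i] rc_toC rc_toC_is_zmod.
HB.instance Definition _ := GRing.isMonoidMorphism.Build K R[i] rc_toC rc_toC_is_monoid.

Lemma rc_toC_real a : rc_toC (rc_of_real a) = (a%:C)%C.
Proof. by rewrite /rc_toC rc_re_real rc_im_real. Qed.

Lemma adjointK m n (X : 'M[K]_(m, n)) : adjoint (adjoint X) = X.
Proof. by apply/matrixP => i j; rewrite !mxE rc_conjK. Qed.

Lemma adjointM m n p (X : 'M[K]_(m, n)) (Y : 'M[K]_(n, p)) :
  adjoint (X *m Y) = adjoint Y *m adjoint X.
Proof. by rewrite /adjoint map_mxM trmx_mul. Qed.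

Lemma adjointD m n (X Y : 'M[K]_(m, n)) : adjoint (X + Y) = adjoint X + adjoint Y.
Proof. by rewrite /adjoint map_mxD linearD. Qed.

Lemma adjointN m n (X : 'M[K]_(m, n)) : adjoint (- X) = - adjoint X.
Proof. by rewrite /adjoint map_mxN linearN. Qed.

Lemma adjoint_scalar n (a : R) :
  adjoint (rc_of_real a)%:M = (rc_of_real a)%:M :> 'M[K]_n.
Proof. by rewrite /adjoint map_scalar_mx tr_scalar_mx /= rc_conj_real. Qed.

Lemma adjoint_inv n (X : 'M[K]_n) : adjoint (invmx X) = invmx (adjoint X).
Proof. by rewrite /adjoint map_invmx trmx_inv. Qed.

Lemma Sym_mx_sum n (I : Type) (r : seq I) (X : I -> 'M[K]_n) :
  (forall i, Sym_mx R b n (X i)) -> Sym_mx R b n (\sum_(i <- r) X i).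
Proof.
move=> SX; rewrite /Sym_mx /= /adjoint map_mx_sum linear_sum.
by apply: eq_bigr => i _; exact: SX.
Qed.

Lemma Sym_mxZ n (a : R) (X : 'M[K]_n) :
  Sym_mx R b n X -> Sym_mx R b n (rc_of_real a *: X).
Proof. by rewrite /Sym_mx /= => XS; rewrite /adjoint map_mxZ linearZ /= rc_conj_real -/(adjoint X) XS. Qed.

Lemma Sym_mxD n (X Y : 'M[K]_n) :
  Sym_mx R b n X -> Sym_mx R b n Y -> Sym_mx R b n (X + Y).
Proof. by rewrite /Sym_mx /= => XS YS; rewrite adjointD XS YS. Qed.

Lemma Sym_mxB n (X Y : 'M[K]_n) :
  Sym_mx R b n X -> Sym_mx R b n Y -> Sym_mx R b n (X - Y).
Proof. by rewrite /Sym_mx /= => XS YS; rewrite adjointD adjointN XS YS. Qed.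

Lemma Sym_mx_scalar n (a : R) : Sym_mx R b n (rc_of_real a)%:M.
Proof. exact: adjoint_scalar. Qed.

Lemma Sym_mx_congr m n (X : 'M[K]_n) (U : 'M[K]_(n, m)) :
  Sym_mx R b n X -> Sym_mx R b m (adjoint U *m X *m U).
Proof. by rewrite /Sym_mx /= => XS; rewrite !adjointM adjointK XS mulmxA. Qed.

(** Bridges two notions of orthogonality: [trace_perp] asks that the trace vanish in the base field,
    while [trace_pairing] below retains its real part only. *)
Lemma Sym_tr_real n (X Y : 'M[K]_n) : Sym_mx R b n X -> Sym_mx R b n Y ->
  rc_im (\tr (X *m Y)) = 0.
Proof.
rewrite /Sym_mx /= => XS YS.
have E : rc_conj (\tr (X *m Y)) = \tr (X *m Y).
  rewrite -[in LHS]XS -[in LHS]YS -adjointM /adjoint mxtrace_tr trace_map_mx.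
  by rewrite /= rc_conjK mxtrace_mulC.
by have := rc_im_conj (\tr (X *m Y)); rewrite E; lra.
Qed.

End BaseField.

(** * The ordered eigenvalues as functions of the matrix *)

Section EigenvalueFunctions.
Local Open Scope sesquilinear_scope.
Context {R : realType} {b : base_field}.
Local Notation K := (rc_scalar R b).

Lemma rank_diag_mx (F : fieldType) n (D : 'rV[F]_n) :
  \rank (diag_mx D) = #|[set i | D 0 i != 0]%SET|.
Proof.
transitivity (\sum_(i < n) nat_of_bool (D 0%R i != 0%R))%N; last first.
  by rewrite -sum1_card [RHS]big_mkcond /=; apply: eq_bigr => i _; rewrite inE; case: eqP.
elim: n D => [|n IH]; first by move=> D; rewrite big_ord0; apply/eqP; rewrite -leqn0 rank_leq_row.
suff S (D : 'rV[F]_(1 + n)) :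
  \rank (diag_mx D) = (\sum_(i < 1 + n) nat_of_bool (D 0%R i != 0%R))%N by exact: S.
rewrite -{1}(hsubmxK D) diag_mx_row rank_diag_block_mx IH big_ord_recl.
congr (_ + _)%N; last first.
  by apply: eq_bigr => i _; rewrite mxE; congr (nat_of_bool (D _ _ != 0)); apply: val_inj.
rewrite rank_rV; congr (nat_of_bool (~~ _)).
apply/eqP/eqP => [/matrixP/(_ 0 0)|D0].
  by rewrite !mxE eqxx mulr1n => <-; congr (D _ _); apply: val_inj.
apply/matrixP => i j; rewrite !ord1 !mxE eqxx mulr1n -[RHS]D0.
by congr (D _ _); apply: val_inj.
Qed.

Lemma toC_adjoint n (X : 'M[K]_n) : map_mx rc_toC (adjoint X) = (map_mx rc_toC X)^t*.
Proof.
apply/matrixP => i j; rewrite !mxE /rc_toC rc_re_conj rc_im_conj.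
by [].
Qed.

(** Shows that the default of the choice in [eigvals] is never taken: a sorted factorization exists
    over [R[i]], has real roots, and descends because [map_poly rc_toC] is injective. *)
Lemma eigvalsP n (X : 'M[K]_n) : Sym_mx R b n X ->
  [/\ sorted <=%R (eigvals X), size (eigvals X) = n &
   exists2 Q : 'M[R[i]]_n, Q \is unitarymx &
     map_mx rc_toC X = Q^t* *m rdiag n (eigvals X) *m Q].
Proof.
move=> XS.
have Xh : (map_mx rc_toC X)^t* = map_mx rc_toC X by rewrite -toC_adjoint XS.
have toC_prod (s : seq R) :
    map_poly rc_toC (\prod_(a <- s) ('X - (rc_of_real a : K)%:P)) =
    \prod_(a <- s) ('X - ((a%:C)%C)%:P).
  rewrite rmorph_prod; apply: eq_bigr => a _.
  by rewrite /= rmorphB /= map_polyX map_polyC /= rc_toC_real.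
have [s [ss sX]] : exists s : seq R, sorted <=%R s /\
    char_poly X = \prod_(a <- s) ('X - (rc_of_real a : K)%:P).
  have [s sn [Q Qu XE]] := hermitian_diagonal Xh.
  exists (sort <=%R s); split; first exact: sort_le_sorted.
  apply: (map_poly_inj rc_toC); rewrite toC_prod map_char_poly XE char_poly_rdiag //.
  by apply: perm_big; rewrite perm_sym perm_sort.
rewrite /eigvals; case: xgetP => [t _ [ts tX]|/(_ s)]; last by case.
have [tn [Q Qu XE]] : size t = n /\ exists2 Q : 'M[R[i]]_n, Q \is unitarymx &
    map_mx rc_toC X = Q^t* *m rdiag n t *m Q.
  by apply: hermitian_diagonal_perm => //; rewrite -map_char_poly tX toC_prod.
by split=> //; exists Q.
Qed.

(** After diagonalization the rank counts the nonzero diagonal entries. Here [a] need not be an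
    eigenvalue, so ranks at different points can be compared as cardinals of index sets. *)
Lemma rank_sub_scalar n (X : 'M[K]_n) (a : R) : Sym_mx R b n X ->
  \rank (X - (rc_of_real a)%:M) = #|[set i : 'I_n | eigval i X != a]%SET|.
Proof.
move=> /eigvalsP [_ _ [Q Qu XE]].
rewrite -(mxrank_map rc_toC) map_mxB map_scalar_mx /= rc_toC_real XE.
have Qu' := unitarymx_unit Qu.
have -> : Q^t* *m rdiag n (eigvals X) *m Q - (a%:C)%C%:M =
    Q^t* *m diag_mx (\row_i ((eigval i X - a)%:C)%C) *m Q.
  rewrite -(invmx_unitary Qu).
  have -> : diag_mx (\row_i ((eigval i X - a)%:C)%C) = rdiag n (eigvals X) - (a%:C)%C%:M.
    apply/matrixP => i j; rewrite !mxE /eigval.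
    by case: eqP => [->|]; rewrite ?mulr1n ?mulr0n ?subr0 // rmorphB.
  by rewrite mulmxBr mulmxBl scalar_mxC -(mulmxA (a%:C)%C%:M) mulVmx // mulmx1.
rewrite mxrankMfree ?row_free_unit // eqmxMfull; last first.
  by rewrite row_full_unit -invmx_unitary // unitmx_inv.
rewrite rank_diag_mx; congr #|pred_of_set _|; apply/finset.setP => i; rewrite !inE mxE.
by rewrite -(rmorph0 (real_complex R)) (inj_eq (@complexI R)) subr_eq0.
Qed.

Lemma eig_mult_rank n (k : 'I_n) (X : 'M[K]_n) :
  eig_mult k X = (n - \rank (X - (rc_of_real (eigval k X))%:M)%R)%N.
Proof. by rewrite /eig_mult /eigenspace mxrank_ker. Qed.

Lemma eigval_lipschitz n (k : 'I_n) (X Y : 'M[K]_n) (e : R) :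
  Sym_mx R b n X -> Sym_mx R b n Y ->
  (forall i j, `|rc_re (X i j) - rc_re (Y i j)| <= e /\
               `|rc_im (X i j) - rc_im (Y i j)| <= e) ->
  `|eigval k X - eigval k Y| <= n%:R ^+ 2 * (2 * e).
Proof.
move=> XS YS XYe.
have [Xs Xn [Q Qu XE]] := eigvalsP XS; have [Ys Yn [P Pu YE]] := eigvalsP YS.
(* The factor 2 in the statement comes from bounding a modulus by the sum of the moduli of real and
   imaginary parts. *)
have ne (x y u v : R) : `|x - y| <= e -> `|u - v| <= e ->
    `|(x +i* u)%C - (y +i* v)%C| <= ((2 * e)%:C)%C.
  move=> xy uv.
  have -> : (x +i* u)%C - (y +i* v)%C = ((x - y)%:C)%C + 'i%C * ((u - v)%:C)%C.
    by rewrite [LHS]complexE.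
  apply: le_trans (ler_normD _ _) _.
  rewrite normrM !normc_def /= !expr0n /= !addr0 !sqrtr_sqr add0r expr1n sqrtr1.
  by rewrite mul1r -rmorphD lecR; lra.
have XYle : eigval k X <= eigval k Y + n%:R ^+ 2 * (2 * e).
  apply: eigenvalue_perturbation XE YE _ => // i j; rewrite !mxE.
  by have [? ?] := XYe i j; exact: ne.
have YXle : eigval k Y <= eigval k X + n%:R ^+ 2 * (2 * e).
  apply: eigenvalue_perturbation YE XE _ => // i j; rewrite !mxE.
  by have [? ?] := XYe i j; apply: ne; rewrite distrC.
by rewrite ler_distl XYle andbT lerBlDr YXle.
Qed.

Section Continuity.
Context {T : Type} (F : set_system T) {FF : Filter F} (n : nat).
Variables (X : T -> 'M[K]_n) (X0 : 'M[K]_n).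
Hypothesis XS : forall y, Sym_mx R b n (X y).
Hypothesis X0S : Sym_mx R b n X0.
Hypothesis Xc : forall i j, rc_re (X y i j) @[y --> F] --> rc_re (X0 i j) /\
  rc_im (X y i j) @[y --> F] --> rc_im (X0 i j).

Lemma eigval_near (e : R) : 0 < e ->
  \forall y \near F, forall k, `|eigval k (X y) - eigval k X0| < e.
Proof.
move=> e0; pose c := e / (n%:R ^+ 2 * 2 + 1).
have N0 : 0 < n%:R ^+ 2 * 2 + 1 :> R by rewrite ltr_wpDl // mulr_ge0 // sqr_ge0.
have c0 : 0 < c by rewrite divr_gt0.
have : \forall y \near F, forall p : 'I_n * 'I_n,
    `|rc_re (X y p.1 p.2) - rc_re (X0 p.1 p.2)| <= c /\
    `|rc_im (X y p.1 p.2) - rc_im (X0 p.1 p.2)| <= c.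
  apply: filter_forall => -[i j] /=; have [re im] := Xc i j; near=> y; split.
    rewrite distrC; near: y; exact: (cvgrPdist_le _ _).1 re _ c0.
  rewrite distrC; near: y; exact: (cvgrPdist_le _ _).1 im _ c0.
apply: filterS => y H k.
apply: le_lt_trans (eigval_lipschitz k (XS y) X0S (fun i j => H (i, j))) _.
rewrite mulrA /c mulrA ltr_pdivrMr // mulrC ltr_pM2l //; lra.
Unshelve. all: by end_near. Qed.

(** Take [e] at most half the gap between l and the other eigenvalues of [X0]. Near [X0], an index
    whose eigenvalue differs from l still has its eigenvalue away from [a]; equality of ranks turns
    this inclusion of index sets into an equality, and [k] lies outside the first set, hence outside
    the second. *)
Lemma eigval_isolated (k : 'I_n) :
  exists2 e : R, 0 < e & \forall y \near F, forall a : R,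
    `|a - eigval k X0| < e ->
    \rank (X y - (rc_of_real a)%:M) = \rank (X0 - (rc_of_real (eigval k X0))%:M) ->
    eigval k (X y) = a.
Proof.
set l := eigval k X0.
have [e e0 He] : exists2 e : R, 0 < e &
    forall j, eigval j X0 != l -> 2 * e <= `|eigval j X0 - l|.
  near ((0 : R)^'+) => e; exists e; first by near: e; exact: nbhs_right_gt.
  near: e; apply: filter_forall => j; have [->|jl] := eqVneq (eigval j X0) l.
    exact: nearW.
  have p0 : 0 < `|eigval j X0 - l| / 2 by rewrite divr_gt0 // normr_gt0 subr_eq0.
  near=> e => _; rewrite mulrC -ler_pdivlMr //.
  by near: e; exact: nbhs_right_le.
exists e => //; near=> y => a al rk.
have close : forall j, `|eigval j (X y) - eigval j X0| < e.
  by near: y; exact: eigval_near.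
rewrite !rank_sub_scalar // in rk.
have sub : [set i | eigval i X0 != l]%SET \subset [set i | eigval i (X y) != a]%SET.
  apply/fintype.subsetP => i; rewrite !inE => il; apply/eqP => ia.
  have := He _ il; apply/negP; rewrite -ltNge mulr_natl mulr2n.
  by apply: le_lt_trans (ler_distD a _ _) (ltrD _ al); rewrite -ia distrC.
have /eqP E : [set i | eigval i X0 != l]%SET == [set i | eigval i (X y) != a]%SET.
  by rewrite eqEcard sub rk leqnn.
have : k \notin [set i | eigval i X0 != l]%SET by rewrite inE eqxx.
by rewrite E inE negbK => /eqP.
Unshelve. all: by end_near. Qed.

End Continuity.
End EigenvalueFunctions.

(** * Linear algebra of the space of symmetric matrices *)

Section LinearAlgebra.

Lemma rank_block_schur (F : fieldType) m1 m2 (A : 'M[F]_m1) (B : 'M[F]_(m1, m2))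
    (C : 'M[F]_(m2, m1)) (D : 'M[F]_m2) :
  D \in unitmx ->
  \rank (block_mx A B C D) = (m2 + \rank (A - B *m invmx D *m C)%R)%N.
Proof.
move=> Du.
have -> : block_mx A B C D =
    block_mx 1%:M (B *m invmx D) 0 1%:M *m
    block_mx (A - B *m invmx D *m C) 0 0 D *m block_mx 1%:M 0 (invmx D *m C) 1%:M.
  rewrite !mulmx_block !(mul0mx, mulmx0, mul1mx, mulmx1, add0r, addr0).
  by rewrite mulmxKV // mulKVmx // mulmxA subrK.
rewrite mxrankMfree; last first.
  by rewrite row_free_unit unitmxE det_lblock !det1 mulr1 unitr1.
rewrite eqmxMfull; last by rewrite row_full_unit unitmxE det_ublock !det1 mulr1 unitr1.
by rewrite rank_diag_block_mx addnC mxrank_unit.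
Qed.

(** Invertibility of the completed matrix is stated as [row_free] because nu + m equals n only
    propositionally, so [row_mx U W] does not have the type of a square matrix. *)
Lemma complement_columns (F : fieldType) n nu (U : 'M[F]_(n, nu)) :
  \rank U = nu ->
  exists m (W : 'M[F]_(n, m)), (nu + m)%N = n /\ row_free (row_mx U W).
Proof.
move=> rU.
exists (\rank (U^T^C)%MS), (row_base (U^T^C)%MS)^T; split.
  rewrite mxrank_compl mxrank_tr rU subnKC // -rU; exact: rank_leq_row.
rewrite /row_free -mxrank_tr tr_row_mx trmxK -addsmxE.
rewrite (adds_eqmx (eqmx_refl _) (eq_row_base _)).
have /eqP -> := addsmx_compl_full U^T.
by [].
Qed.

(** An independent family is enlarged by a vector of [L] outside its span as long as there is one;
    the induction is on a bound [j] for the room N - D that is left. *)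
Lemma subspace_basis (F : fieldType) N (L : set 'rV[F]_N) :
  L 0 -> (forall a u v, L u -> L v -> L (a *: u + v)) ->
  exists D (E : 'M[F]_(D, N)), row_free E /\ forall u, L u <-> (u <= E)%MS.
Proof.
move=> L0 LD.
suff H j : forall D (E : 'M[F]_(D, N)), (N - D <= j)%N -> row_free E ->
    (forall i, L (row i E)) ->
    exists D (E : 'M[F]_(D, N)), row_free E /\ forall u, L u <-> (u <= E)%MS.
  apply: (H N 0%N 0) => [||[]//]; first exact: leq_subr.
  by rewrite /row_free mxrank0.
have subL D (E : 'M[F]_(D, N)) u : (forall i, L (row i E)) -> (u <= E)%MS -> L u.
  move=> LE /submxP [w ->]; rewrite mulmx_sum_row.
  by elim/big_rec: _ => // i x _ Lx; exact: LD.
elim: j => [|j IH] D E Dj Ef LE.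
  exists D, E; split=> // u; split; last exact: subL.
  move=> _; apply: submx_full; rewrite /row_full.
  have := rank_leq_col E; move/eqP: (Ef) => ->; move: Dj; rewrite leqn0 subn_eq0 => ND DN.
  by rewrite eqn_leq DN.
have [[u Lu uE]|H] := pselect (exists2 u, L u & ~~ (u <= E)%MS); last first.
  exists D, E; split=> // u; split; last exact: subL.
  by move=> Lu; apply: contrapT => /negP uE; apply: H; exists u.
have rk : \rank (col_mx E u) = (D + 1)%N.
  have := mxrank_sum_cap E u; rewrite -addsmxE (eqP Ef).
  have u0 : u != 0 by apply: contraNneq uE => ->; rewrite sub0mx.
  rewrite (_ : \rank (E :&: u)%MS = 0%N) ?addn0; first by rewrite rank_rV u0.
  apply/eqP; rewrite -leqn0 leqNgt; apply: contra uE => cap.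
  have cu : (E :&: u == u)%MS.
    rewrite -(geq_leqif (mxrank_leqif_eq (capmxSr E u))) rank_rV u0; exact: cap.
  by rewrite -(eqmxP cu) capmxSl.
apply: (IH (D + 1)%N (col_mx E u)).
- have := rank_leq_col (col_mx E u); rewrite rk; move: Dj; lia.
- by rewrite /row_free rk.
- move=> i; case: (split_ordP i) => i' ->; first by rewrite rowKu; exact: LE.
  by rewrite rowKd row_id.
Qed.

End LinearAlgebra.

(** * Symmetric matrices as a real inner product space *)

Section SymmetricSpace.
Context {R : realType} {b : base_field}.
Local Notation K := (rc_scalar R b).

(** Symmetric matrices form a real subspace, which over the complex numbers is not a complex one;
    these coordinates make real row-space arguments available for it. *)
Definition real_coords n (X : 'M[K]_n) : 'rV[R]_(n * n + n * n) :=
  row_mx (mxvec (map_mx rc_re X)) (mxvec (map_mx rc_im X)).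

Lemma real_coords_inj n : injective (@real_coords n).
Proof.
move=> X Y /eq_row_mx [/(can_inj mxvecK) re /(can_inj mxvecK) im].
apply/matrixP => i j; move/matrixP/(_ i j): re; move/matrixP/(_ i j): im.
by rewrite !mxE => im re; exact: rc_eqP.
Qed.

Lemma real_coords_lin n a (X Y : 'M[K]_n) :
  real_coords (rc_of_real a *: X + Y) = a *: real_coords X + real_coords Y.
Proof.
rewrite /real_coords scale_row_mx add_row_mx -!linearP /=.
congr (row_mx (mxvec _) (mxvec _)); apply/matrixP => i j; rewrite !mxE.
  by rewrite rc_reD rc_reM rc_re_real rc_im_real mul0r subr0.
by rewrite rc_imD rc_imM rc_re_real rc_im_real mul0r addr0.
Qed.

Lemma real_coords_sum n D (a : 'rV[R]_D) (e : 'I_D -> 'M[K]_n) :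
  real_coords (\sum_i rc_of_real (a 0 i) *: e i) = \sum_i a 0 i *: real_coords (e i).
Proof.
have r0 : real_coords (0 : 'M[K]_n) = 0.
  by have := real_coords_lin (-1) (0 : 'M[K]_n) 0; rewrite scaler0 addr0 scaleN1r addNr.
elim/big_rec2: _ => // i x y _ <-; exact: real_coords_lin.
Qed.

Lemma real_basis_exists n : exists D (e : 'I_D -> 'M[K]_n), real_basis (Sym_mx R b n) e.
Proof.
pose L := @real_coords n @` Sym_mx R b n.
have [||D [E [Ef LE]]] := @subspace_basis R _ L.
- exists 0; first by rewrite /Sym_mx /= /adjoint map_mx0 trmx0.
  by have := real_coords_lin (-1) (0 : 'M[K]_n) 0; rewrite scaler0 addr0 scaleN1r addNr.
- move=> a _ _ [X XS <-] [Y YS <-]; exists (rc_of_real a *: X + Y).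
    by apply: Sym_mxD => //; exact: Sym_mxZ.
  exact: real_coords_lin.
have /choice [e eP] : forall i, exists X : 'M[K]_n, Sym_mx R b n X /\ real_coords X = row i E.
  by move=> i; have [X XS XE] := (LE (row i E)).2 (row_sub i E); exists X.
exists D, e; split=> [i|X XS]; first exact: (eP i).1.
have sumE (a : 'rV[R]_D) : real_coords (\sum_i rc_of_real (a 0 i) *: e i) = a *m E.
  by rewrite real_coords_sum mulmx_sum_row; apply: eq_bigr => i _; rewrite (eP i).2.
have /submxP [a aE] : (real_coords X <= E)%MS by apply/LE; exists X.
exists a; split; first by apply: real_coords_inj; rewrite sumE.
move=> a' XE; apply: (row_free_inj Ef).
by rewrite -aE XE sumE.
Qed.

Lemma real_dimP n : exists e : 'I_(real_dim (Sym_mx R b n)) -> 'M[K]_n,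
  real_basis (Sym_mx R b n) e.
Proof.
rewrite /real_dim; case: xgetP => [D _ //|H].
by have [D eP] := real_basis_exists n; have := H D eP.
Qed.

Lemma posdef_trace_gt0 n (B : 'M[K]_n) : (0 < n)%N -> posdef B -> 0 < rc_re (\tr B).
Proof.
move=> n0 [BS Bp].
have Bii i : 0 < rc_re (B i i).
  pose v : 'cV[K]_n := delta_mx i 0; have := Bp v.
  have -> : (adjoint v *m B *m v) 0 0 = B i i.
    have -> : adjoint v *m B = row i B.
      by rewrite rowE; congr (_ *m _); rewrite /adjoint map_delta_mx trmx_delta.
    rewrite mxE (bigD1 i) //= big1 ?addr0 => [|j ji].
      by rewrite !mxE !eqxx mulr1.
    by rewrite !mxE (negbTE ji) mulr0.
  move=> H; have {H} : 0 < B i i.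
    apply: H; apply/eqP => /matrixP/(_ i 0)/eqP.
    by rewrite !mxE !eqxx oner_eq0.
  by case: (b) (B i i) => //= -[x y]; rewrite ltcE /= => /andP[].
have reS : {morph (@rc_re R b) : x y / x + y >-> x + y} by move=> x y; exact: rc_reD.
rewrite /mxtrace (big_morph (@rc_re R b) reS (@rc_re0 R b)).
rewrite (bigD1 (Ordinal n0)) //= ltr_pwDl // sumr_ge0 // => i _; exact: ltW.
Qed.

Lemma rc_re_sum (I : Type) (r : seq I) (P : pred I) (f : I -> K) :
  rc_re (\sum_(i <- r | P i) f i) = \sum_(i <- r | P i) rc_re (f i).
Proof. by apply: (big_morph (@rc_re R b)); [exact: rc_reD|exact: rc_re0]. Qed.

(** Taking the real part gives a real-bilinear form on all matrices, equal to Tr(XY) when both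
    arguments are symmetric. *)
Definition trace_pairing n (X Y : 'M[K]_n) : R := rc_re (\tr (X *m Y)).

Lemma trace_pairing_suml n D (a : 'rV[R]_D) (e : 'I_D -> 'M[K]_n) Y :
  trace_pairing (\sum_i rc_of_real (a 0 i) *: e i) Y = \sum_i a 0 i * trace_pairing (e i) Y.
Proof.
rewrite /trace_pairing mulmx_suml linear_sum rc_re_sum; apply: eq_bigr => i _.
by rewrite -scalemxAl linearZ /= rc_reM rc_re_real rc_im_real mul0r subr0.
Qed.

Lemma trace_pairing_eq0 n (X : 'M[K]_n) :
  Sym_mx R b n X -> trace_pairing X X = 0 -> X = 0.
Proof.
move=> XS; rewrite /trace_pairing.
have -> : rc_re (\tr (X *m X)) = \sum_i \sum_j rc_norm2 (X i j).
  rewrite /mxtrace rc_re_sum; apply: eq_bigr => i _; rewrite mxE rc_re_sum.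
  apply: eq_bigr => j _; rewrite -{2}XS !mxE rc_reM rc_re_conj rc_im_conj.
  by rewrite /rc_norm2; ring.
have n0 (z : K) : 0 <= rc_norm2 z by rewrite addr_ge0 // sqr_ge0.
move=> /eqP; rewrite psumr_eq0 => [/allP H|i _]; last by rewrite sumr_ge0.
apply/matrixP => i j; have := H i (mem_index_enum _).
rewrite psumr_eq0 // => /allP/(_ j (mem_index_enum _)).
by rewrite implyTb rc_norm2_eq0 mxE => /eqP.
Qed.

Lemma real_basis_pairing_inj n D (e : 'I_D -> 'M[K]_n) X :
  real_basis (Sym_mx R b n) e -> Sym_mx R b n X ->
  (forall j, trace_pairing (e j) X = 0) -> X = 0.
Proof.
move=> [_ eP] XS H; apply: trace_pairing_eq0 => //.
have [a [aE _]] := eP X XS; rewrite [X in trace_pairing X _]aE trace_pairing_suml.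
by rewrite big1 // => j _; rewrite H mulr0.
Qed.

(* The annihilator of the row space of J is the line of coordinates of B. *)
Lemma rank_trace_perp n D p (e : 'I_D -> 'M[K]_n) (B : 'M[K]_n)
    (Y : 'I_p -> 'M[K]_n) :
  real_basis (Sym_mx R b n) e -> B != 0 -> Sym_mx R b n B ->
  (forall i, trace_pairing B (Y i) = 0) ->
  (forall X, Sym_mx R b n X -> (forall i, trace_pairing X (Y i) = 0) -> real_span B X) ->
  let J := \matrix_(i < p, j < D) trace_pairing (e j) (Y i) in
  \rank J = D.-1 /\
  forall Z, trace_pairing B Z = 0 -> (\row_j trace_pairing (e j) Z <= J)%MS.
Proof.
move=> [eS eP] B0 BS BY spanB J.
have [bb [bE bU]] := eP B BS.
have pairE Z : trace_pairing B Z = ((\row_j trace_pairing (e j) Z) *m bb^T) 0 0.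
  rewrite {1}bE trace_pairing_suml mxE; apply: eq_bigr => j _.
  by rewrite !mxE mulrC.
have bb0 : bb != 0.
  apply: contra B0 => /eqP bb0; rewrite bE bb0 big1 // => i _.
  by rewrite mxE rmorph0 scale0r.
have rowJ i : row i J = \row_j trace_pairing (e j) (Y i) by apply/rowP => j; rewrite !mxE.
have Jb : J *m bb^T = 0.
  apply/matrixP => i j; rewrite !ord1 [RHS]mxE -(BY i) pairE -rowJ -row_mul.
  by rewrite [RHS]mxE.
(* A vector annihilated by [J] is the coordinate vector of a symmetric matrix orthogonal to every
   [Y i], thus of a multiple of [B]; uniqueness of coordinates carries the factor over to [bb]. *)
have kerJ (a : 'rV[R]_D) : J *m a^T = 0 -> exists c, a = c *: bb.
  move=> Ja; pose X := \sum_i rc_of_real (a 0 i) *: e i.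
  have XS : Sym_mx R b n X by apply: Sym_mx_sum => i; apply: Sym_mxZ; exact: eS.
  have [|c _ cX] := spanB X XS.
    move=> i; rewrite /X trace_pairing_suml.
    have /matrixP/(_ i 0) := Ja; rewrite mxE [RHS]mxE => JaE.
    by rewrite -[RHS]JaE; apply: eq_bigr => j _; rewrite !mxE mulrC.
  exists c; have [a' [a'E a'U]] := eP X XS.
  rewrite -(a'U a) // -(a'U (c *: bb)) // -cX bE scaler_sumr.
  by apply: eq_bigr => i _; rewrite mxE rmorphM scalerA.
(* Membership in the row space of [J] is tested against [cokermx J]. Its columns are multiples of
   [bb], so orthogonality to [B] is enough. *)
have cokE (j : 'I_D) : exists c, (col j (cokermx J))^T = c *: bb.
  by apply: kerJ; rewrite trmxK colE mulmxA mulmx_coker mul0mx.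
split; last first.
  move=> Z BZ; rewrite submxE; apply/eqP/matrixP => i j; rewrite ord1 [RHS]mxE.
  have [c cE] := cokE j.
  transitivity ((\row_j0 trace_pairing (e j0) Z *m (c *: bb)^T) 0 0).
    rewrite -cE trmxK [LHS]mxE [RHS]mxE; apply: eq_bigr => l _.
    by rewrite [col _ _ _ _]mxE.
  by rewrite linearZ /= -scalemxAr mxE -pairE BZ mulr0.
have rb : \rank bb = 1%N by rewrite rank_rV bb0.
have kE : (kermx J^T :=: bb)%MS.
  apply/eqmxP/andP; split.
    apply/row_subP => i.
    have [c ->] : exists c, row i (kermx J^T) = c *: bb.
      apply: kerJ; apply: trmx_inj; rewrite trmx_mul trmxK trmx0.
      by rewrite -row_mul mulmx_ker row0.
    exact: scalemx_sub.
  by apply/sub_kermxP; apply: trmx_inj; rewrite trmx_mul trmxK trmx0.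
have := mxrank_ker J^T; rewrite kE rb mxrank_tr.
have := rank_leq_col J; lia.
Qed.

End SymmetricSpace.

(** * Smooth families of matrices *)

Section ScalarValuedCalculus.
Context {R : realType} {b : base_field} {V : normedModType R}.
Local Notation K := (rc_scalar R b).

(** Regularity over the base field takes the form in which [smooth_family] supplies it. Likewise
    [scalar_derive] below has the shape used in [dfamily], so that the two derivatives match by
    unfolding. *)
Definition Ck_scalar k (U : set V) (f : V -> K) : Prop :=
  Ck_on k U (fun x => rc_re (f x)) /\ Ck_on k U (fun x => rc_im (f x)).

Definition Ck_mx k (U : set V) m n (X : V -> 'M[K]_(m, n)) : Prop :=
  forall i j, Ck_scalar k U (fun x => X x i j).

Definition scalar_derive (v : V) (f : V -> K) (x : V) : K :=
  rc_of_parts ('D_v (fun y => rc_re (f y)) x) ('D_v (fun y => rc_im (f y)) x).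

Definition mx_derive (v : V) m n (X : V -> 'M[K]_(m, n)) (x : V) : 'M[K]_(m, n) :=
  \matrix_(i, j) scalar_derive v (fun y => X y i j) x.

Section Smoothness.
Variables (k : nat) (U : set V).
Hypothesis oU : open U.

Lemma eq_Ck_scalar (f g : V -> K) :
  (forall x, U x -> f x = g x) -> Ck_scalar k U f -> Ck_scalar k U g.
Proof.
by move=> fg [re im]; split;
  [apply: eq_Ck_on re|apply: eq_Ck_on im] => // x Ux; rewrite fg.
Qed.

Lemma Ck_scalar_cst (a : K) : Ck_scalar k U (fun=> a).
Proof. by split; exact: Ck_on_cst. Qed.

Lemma Ck_scalarD (f g : V -> K) :
  Ck_scalar k U f -> Ck_scalar k U g -> Ck_scalar k U (fun x => f x + g x).
Proof.
move=> [fr fi] [gr gi]; split.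
  by under eq_fun do rewrite rc_reD; exact: Ck_onD.
by under eq_fun do rewrite rc_imD; exact: Ck_onD.
Qed.

Lemma Ck_scalarN (f : V -> K) : Ck_scalar k U f -> Ck_scalar k U (fun x => - f x).
Proof.
move=> [fr fi]; split.
  by under eq_fun do rewrite rc_reN; exact: Ck_onN.
by under eq_fun do rewrite rc_imN; exact: Ck_onN.
Qed.

Lemma Ck_scalarM (f g : V -> K) :
  Ck_scalar k U f -> Ck_scalar k U g -> Ck_scalar k U (fun x => f x * g x).
Proof.
move=> [fr fi] [gr gi]; split.
  under eq_fun do rewrite rc_reM.
  by apply: Ck_onD => //; [|apply: Ck_onN => //]; exact: Ck_onM.
under eq_fun do rewrite rc_imM.
by apply: Ck_onD => //; exact: Ck_onM.
Qed.

Lemma Ck_norm2 (f : V -> K) : Ck_scalar k U f -> Ck_on k U (fun x => rc_norm2 (f x)).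
Proof.
move=> [fr fi]; rewrite /rc_norm2; under eq_fun do rewrite !expr2.
by apply: Ck_onD => //; exact: Ck_onM.
Qed.

Lemma Ck_scalarV (f : V -> K) : (forall x, U x -> f x != 0) ->
  Ck_scalar k U f -> Ck_scalar k U (fun x => (f x)^-1).
Proof.
move=> f0 Cf; have [fr fi] := Cf.
have Ni : Ck_on k U (fun x => (rc_norm2 (f x))^-1).
  by apply: Ck_onV; [|move=> x Ux; rewrite rc_norm2_eq0 f0|exact: Ck_norm2].
split; first by under eq_fun do rewrite rc_reV; exact: Ck_onM.
by under eq_fun do rewrite rc_imV; apply: Ck_onM => //; exact: Ck_onN.
Qed.

Lemma Ck_scalar_sum (I : Type) (r : seq I) (f : I -> V -> K) :
  (forall i, Ck_scalar k U (f i)) -> Ck_scalar k U (fun x => \sum_(i <- r) f i x).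
Proof.
by apply: (closed_sum (P := Ck_scalar k U)); [exact: Ck_scalar_cst|exact: Ck_scalarD].
Qed.

Lemma Ck_mx_det n (X : V -> 'M[K]_n) : Ck_mx k U X -> Ck_scalar k U (fun x => \det (X x)).
Proof.
by apply: (closed_det (P := Ck_scalar k U));
  [exact: Ck_scalar_cst|exact: Ck_scalarD|exact: Ck_scalarM].
Qed.

Lemma Ck_mx_cst m n (A : 'M[K]_(m, n)) : Ck_mx k U (fun=> A).
Proof. by move=> i j; exact: Ck_scalar_cst. Qed.

Lemma Ck_mxD m n (X Y : V -> 'M[K]_(m, n)) :
  Ck_mx k U X -> Ck_mx k U Y -> Ck_mx k U (fun x => X x + Y x).
Proof.
by move=> CX CY i j; under eq_fun do rewrite mxE; exact: Ck_scalarD.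
Qed.

Lemma Ck_mxN m n (X : V -> 'M[K]_(m, n)) :
  Ck_mx k U X -> Ck_mx k U (fun x => - X x).
Proof. by move=> CX i j; under eq_fun do rewrite mxE; exact: Ck_scalarN. Qed.

Lemma Ck_mxM m n p (X : V -> 'M[K]_(m, n)) (Y : V -> 'M[K]_(n, p)) :
  Ck_mx k U X -> Ck_mx k U Y -> Ck_mx k U (fun x => X x *m Y x).
Proof.
by apply: (closed_mulmx (P := Ck_scalar k U));
  [exact: Ck_scalar_cst|exact: Ck_scalarD|exact: Ck_scalarM].
Qed.

Lemma Ck_mx_inv n (X : V -> 'M[K]_n) : (forall x, U x -> X x \in unitmx) ->
  Ck_mx k U X -> Ck_mx k U (fun x => invmx (X x)).
Proof.
move=> Xu; apply: (closed_invmx (U := U) (P := Ck_scalar k U)) Xu.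
- exact: eq_Ck_scalar.
- exact: Ck_scalar_cst.
- exact: Ck_scalarD.
- exact: Ck_scalarM.
- exact: Ck_scalarV.
Qed.

Lemma Ck_trace_pairing n (A : 'M[K]_n) (X : V -> 'M[K]_n) :
  Ck_mx k U X -> Ck_on k U (fun x => trace_pairing A (X x)).
Proof.
move=> CX; have : Ck_scalar k U (fun x => \sum_i (A *m X x) i i).
  by apply: Ck_scalar_sum => i; exact: (Ck_mxM (Ck_mx_cst A) CX).
by case.
Qed.

End Smoothness.

Section Derivative.
Variables (U : set V) (x : V).
Hypotheses (oU : open U) (Ux : U x).

Let re_diff (f : V -> K) : Ck_scalar 1 U f -> differentiable (fun y => rc_re (f y)) x.
Proof. by move=> [[+ _] _]; exact. Qed.
Let im_diff (f : V -> K) : Ck_scalar 1 U f -> differentiable (fun y => rc_im (f y)) x.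
Proof. by move=> [_ [+ _]]; exact. Qed.

Lemma rc_re_derive v (f : V -> K) :
  rc_re (scalar_derive v f x) = 'D_v (fun y => rc_re (f y)) x.
Proof. by rewrite /scalar_derive; case: (b) f. Qed.

Lemma rc_im_derive v (f : V -> K) :
  rc_im (scalar_derive v f x) = 'D_v (fun y => rc_im (f y)) x.
Proof.
rewrite /scalar_derive; case: (b) f => //= f.
by rewrite (derive_cst (0 : R)).
Qed.

Lemma scalar_derive_cst v (a : K) : scalar_derive v (fun=> a) x = 0.
Proof.
by apply: rc_eqP; rewrite ?rc_re_derive ?rc_im_derive ?rc_re0 ?rc_im0 derive_cst.
Qed.

Lemma scalar_deriveD v (f g : V -> K) : Ck_scalar 1 U f -> Ck_scalar 1 U g ->
  scalar_derive v (fun y => f y + g y) x = scalar_derive v f x + scalar_derive v g x.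
Proof.
move=> Cf Cg.
have [fr fi] := (re_diff Cf, im_diff Cf); have [gr gi] := (re_diff Cg, im_diff Cg).
apply: rc_eqP; rewrite ?rc_reD ?rc_imD !(rc_re_derive, rc_im_derive).
  by under eq_fun do rewrite rc_reD; rewrite deriveD //; exact: diff_derivable.
by under eq_fun do rewrite rc_imD; rewrite deriveD //; exact: diff_derivable.
Qed.

Lemma scalar_deriveM v (f g : V -> K) : Ck_scalar 1 U f -> Ck_scalar 1 U g ->
  scalar_derive v (fun y => f y * g y) x = scalar_derive v f x * g x + f x * scalar_derive v g x.
Proof.
move=> Cf Cg.
have [fr fi] := (re_diff Cf, im_diff Cf); have [gr gi] := (re_diff Cg, im_diff Cg).
have DM (p q : V -> R) : differentiable p x -> differentiable q x ->
    'D_v (fun y => p y * q y) x = 'D_v p x * q x + p x * 'D_v q x.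
  move=> dp dq; rewrite (deriveM (f := p) (g := q)); try exact: diff_derivable.
  by rewrite addrC mulrC.
have dM (p q : V -> R) : differentiable p x -> differentiable q x ->
    derivable (fun y => p y * q y) x v.
  by move=> dp dq; apply: diff_derivable; exact: differentiableM.
apply: rc_eqP; rewrite ?rc_reD ?rc_imD ?rc_reM ?rc_imM !(rc_re_derive, rc_im_derive).
  under eq_fun do rewrite rc_reM.
  rewrite (deriveB (dM _ _ fr gr) (dM _ _ fi gi)) !DM //; ring.
under eq_fun do rewrite rc_imM.
rewrite (deriveD (dM _ _ fr gi) (dM _ _ fi gr)) !DM //; ring.
Qed.

Lemma scalar_derive_sum v (I : Type) (r : seq I) (f : I -> V -> K) :
  (forall i, Ck_scalar 1 U (f i)) ->
  scalar_derive v (fun y => \sum_(i <- r) f i y) x = \sum_(i <- r) scalar_derive v (f i) x.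
Proof.
move=> Cf; elim: r => [|i r IH].
  by under eq_fun do rewrite big_nil; rewrite big_nil scalar_derive_cst.
under eq_fun do rewrite big_cons.
by rewrite scalar_deriveD // ?IH ?big_cons //; exact: Ck_scalar_sum.
Qed.

Lemma mx_derive_cst v m n (A : 'M[K]_(m, n)) : mx_derive v (fun=> A) x = 0.
Proof. by apply/matrixP => i j; rewrite !mxE scalar_derive_cst. Qed.

Lemma mx_deriveD v m n (X Y : V -> 'M[K]_(m, n)) : Ck_mx 1 U X -> Ck_mx 1 U Y ->
  mx_derive v (fun y => X y + Y y) x = mx_derive v X x + mx_derive v Y x.
Proof.
move=> CX CY; apply/matrixP => i j; rewrite !mxE; under eq_fun do rewrite mxE.
exact: scalar_deriveD.
Qed.

Lemma mx_deriveM v m n p (X : V -> 'M[K]_(m, n)) (Y : V -> 'M[K]_(n, p)) :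
  Ck_mx 1 U X -> Ck_mx 1 U Y ->
  mx_derive v (fun y => X y *m Y y) x = mx_derive v X x *m Y x + X x *m mx_derive v Y x.
Proof.
move=> CX CY; apply/matrixP => i j; rewrite !mxE; under eq_fun do rewrite mxE.
rewrite scalar_derive_sum => [|l]; last exact: Ck_scalarM.
rewrite -big_split; apply: eq_bigr => l _ /=.
by rewrite scalar_deriveM // !mxE.
Qed.

Lemma mx_derive_conj v m n p q (A : 'M[K]_(m, n)) (X : V -> 'M[K]_(n, p)) (B : 'M[K]_(p, q)) :
  Ck_mx 1 U X ->
  mx_derive v (fun y => A *m X y *m B) x = A *m mx_derive v X x *m B.
Proof.
move=> CX; have CAX : Ck_mx 1 U (fun y => A *m X y) by apply: Ck_mxM => //; exact: Ck_mx_cst.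
rewrite mx_deriveM //; last exact: Ck_mx_cst.
rewrite mx_derive_cst mulmx0 addr0 mx_deriveM //; last exact: Ck_mx_cst.
by rewrite mx_derive_cst mul0mx add0r.
Qed.

Lemma Sym_mx_derive v n (X : V -> 'M[K]_n) : (forall y, Sym_mx R b n (X y)) ->
  Ck_mx 1 U X -> Sym_mx R b n (mx_derive v X x).
Proof.
move=> XS CX; apply/matrixP => i j; rewrite !mxE.
have XE y : X y i j = rc_conj (X y j i) by rewrite -{1}(XS y) !mxE.
apply: rc_eqP; rewrite ?rc_re_conj ?rc_im_conj !(rc_re_derive, rc_im_derive).
  by under [in RHS]eq_fun do rewrite XE rc_re_conj.
under [in RHS]eq_fun do rewrite XE rc_im_conj.
by rewrite deriveN //; apply: diff_derivable; exact: im_diff (CX j i).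
Qed.

Lemma derive_trace_pairing v n (A : 'M[K]_n) (X : V -> 'M[K]_n) : Ck_mx 1 U X ->
  'D_v (fun y => trace_pairing A (X y)) x = trace_pairing A (mx_derive v X x).
Proof.
move=> CX; have CA : Ck_mx 1 U (fun=> A) by exact: Ck_mx_cst.
have CAX := Ck_mxM oU CA CX.
have -> : trace_pairing A (mx_derive v X x) =
    rc_re (scalar_derive v (fun y => \tr (A *m X y)) x).
  rewrite /trace_pairing /mxtrace scalar_derive_sum //.
  congr rc_re; apply: eq_bigr => i _.
  have := mx_deriveM v CA CX; rewrite mx_derive_cst mul0mx add0r => <-.
  by rewrite mxE.
by rewrite rc_re_derive.
Qed.

End Derivative.
End ScalarValuedCalculus.

(** * Schur complements in a varying symmetric matrix *)

Section SchurComplement.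
Context {R : realType} {b : base_field}.
Local Notation K := (rc_scalar R b).

Definition schur n nu m (U : 'M[K]_(n, nu)) (W : 'M[K]_(n, m)) (Y : 'M[K]_n) : 'M[K]_nu :=
  adjoint U *m Y *m U -
  (adjoint U *m Y *m W) *m invmx (adjoint W *m Y *m W) *m (adjoint W *m Y *m U).

Lemma rank_adjoint_congr n p (Q : 'M[K]_(n, p)) (Y : 'M[K]_n) :
  row_free Q -> \rank (adjoint Q *m Y *m Q) = \rank Y.
Proof.
move=> Qf; rewrite mxrankMfree // eqmxMfull //.
by rewrite /row_full /adjoint mxrank_tr mxrank_map (eqP Qf).
Qed.

Lemma adjoint_congr_block n nu m (U : 'M[K]_(n, nu)) (W : 'M[K]_(n, m)) (Y : 'M[K]_n) :
  adjoint (row_mx U W) *m Y *m row_mx U W =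
  block_mx (adjoint U *m Y *m U) (adjoint U *m Y *m W)
           (adjoint W *m Y *m U) (adjoint W *m Y *m W).
Proof.
by rewrite /adjoint map_row_mx tr_row_mx mul_col_mx mul_col_mx !mul_mx_row.
Qed.

Lemma rank_schur n nu m (U : 'M[K]_(n, nu)) (W : 'M[K]_(n, m)) (Y : 'M[K]_n) :
  row_free (row_mx U W) -> adjoint W *m Y *m W \in unitmx ->
  \rank Y = (m + \rank (schur U W Y))%N.
Proof.
by move=> Qf Du; rewrite -(rank_adjoint_congr Y Qf) adjoint_congr_block rank_block_schur.
Qed.

Lemma Sym_schur n nu m (U : 'M[K]_(n, nu)) (W : 'M[K]_(n, m)) (Y : 'M[K]_n) :
  Sym_mx R b n Y -> Sym_mx R b nu (schur U W Y).
Proof.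
move=> YS; apply: Sym_mxB; first exact: Sym_mx_congr.
have -> : adjoint U *m Y *m W = adjoint (adjoint W *m Y *m U).
  by rewrite !adjointM adjointK YS mulmxA.
apply: Sym_mx_congr; rewrite /Sym_mx /= adjoint_inv.
by congr invmx; exact: Sym_mx_congr.
Qed.

Section Smooth.
Context {V : normedModType R}.
Variables (O : set V) (n nu m : nat) (U : 'M[K]_(n, nu)) (W : 'M[K]_(n, m)).
Variable (Y : V -> 'M[K]_n).
Hypotheses (oO : open O) (Yu : forall x, O x -> adjoint W *m Y x *m W \in unitmx).

Let Ck_conj k p q (A : 'M[K]_(p, n)) (C : 'M[K]_(n, q)) :
  Ck_mx k O Y -> Ck_mx k O (fun x => A *m Y x *m C).
Proof.
move=> CY; apply: Ck_mxM => //; last exact: Ck_mx_cst.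
by apply: Ck_mxM => //; exact: Ck_mx_cst.
Qed.

Let Ck_schur_term k : Ck_mx k O Y -> Ck_mx k O (fun x =>
  (adjoint U *m Y x *m W) *m invmx (adjoint W *m Y x *m W)).
Proof.
move=> CY; apply: Ck_mxM => //; first exact: Ck_conj.
by apply: Ck_mx_inv => //; exact: Ck_conj.
Qed.

Lemma Ck_schur k : Ck_mx k O Y -> Ck_mx k O (fun x => schur U W (Y x)).
Proof.
move=> CY; apply: Ck_mxD => //; first exact: Ck_conj.
apply: Ck_mxN => //; apply: Ck_mxM => //; first exact: Ck_schur_term.
exact: Ck_conj.
Qed.

(* The correction term of the Schur complement vanishes to second order. *)
Lemma mx_derive_schur x v : O x -> Ck_mx 1 O Y -> Y x *m U = 0 -> adjoint U *m Y x = 0 ->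
  mx_derive v (fun y => schur U W (Y y)) x = adjoint U *m mx_derive v Y x *m U.
Proof.
move=> Ox CY YU UY.
have CP := Ck_schur_term CY.
have CQ : Ck_mx 1 O (fun y => adjoint W *m Y y *m U) by exact: Ck_conj.
have CNP := Ck_mxN oO CP.
have -> : (fun y => schur U W (Y y)) = (fun y => adjoint U *m Y y *m U +
    - ((adjoint U *m Y y *m W) *m invmx (adjoint W *m Y y *m W)) *m (adjoint W *m Y y *m U)).
  by apply/funext => y; rewrite /schur mulNmx.
rewrite (mx_deriveD Ox); [|exact: Ck_conj|exact: Ck_mxM].
rewrite (mx_derive_conj oO Ox) // (mx_deriveM oO Ox) //.
by rewrite -(mulmxA (adjoint W)) YU mulmx0 mulmx0 add0r UY !mul0mx oppr0 mul0mx addr0.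
Qed.

End Smooth.

Lemma open_unitmx (V : normedModType R) (O : set V) m (X : V -> 'M[K]_m) :
  open O -> Ck_mx 0 O X -> open [set x | O x /\ X x \in unitmx].
Proof.
move=> oO CX; rewrite openE => x [Ox Xu].
have /Ck_on0P/(_ _ Ox) Nc := Ck_norm2 oO (Ck_mx_det oO CX).
have N0 : rc_norm2 (\det (X x)) != 0 by rewrite rc_norm2_eq0 -unitfE -unitmxE.
have H : \forall y \near x, rc_norm2 (\det (X y)) != 0 by exact: (cvgr_neq0 (rc_norm2 (\det (X x)))).

near=> y; split; first by near: y; exact: open_nbhs_nbhs.
rewrite unitmxE unitfE -rc_norm2_eq0; near: y; exact: H.
Unshelve. all: by end_near. Qed.

End SchurComplement.

(** * Equations of the constant multiplicity set in a chart *)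

Section LocalModel.
Context {R : realType} {b : base_field}.
Local Notation K := (rc_scalar R b).
Variables (d n nu : nat) (O : set 'rV[R]_d) (X : 'rV[R]_d -> 'M[K]_n) (k : 'I_n).
Variables (t0 : 'rV[R]_d) (U : 'M[K]_(n, nu)) (B : 'M[K]_nu).
Hypotheses (oO : open O) (Ot0 : O t0) (CX : forall j, Ck_mx j O X).
Hypotheses (XS : forall t, Sym_mx R b n (X t)) (nu0 : (0 < nu)%N).
Hypothesis mult0 : eig_mult k (X t0) = nu.
Hypothesis UE : isometry_onto U (eig_cspace k (X t0)).
Hypothesis Bp : posdef B.
Let H v := adjoint U *m mx_derive v X t0 *m U.
Hypothesis HB : trace_perp (range H) = real_span B.

Let l0 := eigval k (X t0).
Let BS : Sym_mx R b nu B. Proof. by case: Bp. Qed.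

Let XU : (X t0 - (rc_of_real l0)%:M) *m U = 0.
Proof.
apply/matrixP => i j.
have : (range (fun w : 'cV[K]_nu => U *m w)) (U *m delta_mx j 0) by exists (delta_mx j 0).
rewrite (UE.2) /eig_cspace /= -/l0 -colE => E.
have : (X t0 - (rc_of_real l0)%:M) *m col j U = 0.
  by rewrite mulmxBl mul_scalar_mx E subrr.
by rewrite colE mulmxA -colE => /matrixP/(_ i 0); rewrite !mxE.
Qed.

Let UX : adjoint U *m (X t0 - (rc_of_real l0)%:M) = 0.
Proof.
have YS : Sym_mx R b n (X t0 - (rc_of_real l0)%:M).
  by apply: Sym_mxB => //; exact: Sym_mx_scalar.
by rewrite -[X t0 - _]YS -adjointM XU /adjoint map_mx0 trmx0.
Qed.

Let shifted (p : 'rV[R]_(d + 1)) : 'M[K]_n :=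
  X (lsubmx p) - (rc_of_real (p 0 (rshift d 0)))%:M.

Let shifted_pair t (a : R) : shifted (row_mx t a%:M) = X t - (rc_of_real a)%:M.
Proof. by rewrite /shifted row_mxKl row_mxEr mxE eqxx mulr1n. Qed.

Let O1 : set 'rV[R]_(d + 1) := lsubmx @^-1` O.

Let oO1 : open O1.
Proof. by apply: open_comp => // p _; exact: continuous_lsubmx. Qed.

Let C_last j (S : set 'rV[R]_(d + 1)) : Ck_on j S (fun p : 'rV[R]_(d + 1) => p 0 (rshift d 0)).
Proof.
apply: (Ck_on_subset (U := setT)) => //.
apply: (Ck_on_entry (f := id) 0 (rshift d 0)) => //; first exact: openT.
by apply: (@Ck_on_linear _ _ _ _ _ idfun) => p.
Qed.

Let scalar_entry (a : R) (i j : 'I_n) :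
  ((rc_of_real a)%:M : 'M[K]_n) i j = rc_of_real (a * (i == j)%:R).
Proof. by rewrite mxE rmorphM rmorph_nat mulr_natr. Qed.

Let C_scalar j (S : set 'rV[R]_(d + 1)) : open S ->
  Ck_mx j S (fun p : 'rV[R]_(d + 1) => (rc_of_real (p 0 (rshift d 0)))%:M : 'M[K]_n).
Proof.
move=> oS i i'; split.
  under eq_fun do rewrite scalar_entry rc_re_real.
  by apply: Ck_onM => //; exact: Ck_on_cst.
by under eq_fun do rewrite scalar_entry rc_im_real; exact: Ck_on_cst.
Qed.

Let C_X j : Ck_mx j O1 (fun p => X (lsubmx p)).
Proof.
have Cl : Ck_on j O1 (lsubmx : 'rV[R]_(d + 1) -> 'rV[R]_d).
  by apply: (@Ck_on_linear _ _ _ _ _ lsubmx); exact: continuous_lsubmx.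
by move=> i i'; have [re im] := CX j i i'; split;
  [apply: Ck_on_comp Cl re|apply: Ck_on_comp Cl im].
Qed.

Let C_shifted j : Ck_mx j O1 shifted.
Proof. by apply: Ck_mxD => //; apply: Ck_mxN => //; exact: C_scalar. Qed.

Let derive_shifted v w : mx_derive (row_mx v w%:M) shifted (row_mx t0 l0%:M) =
  mx_derive v X t0 - (rc_of_real w)%:M.
Proof.
set p0 := row_mx t0 _; have O1p0 : O1 p0 by rewrite /O1 /= row_mxKl.
have Cs := C_scalar 1 oO1.
rewrite (mx_deriveD O1p0 _ (C_X 1)); last exact: Ck_mxN.
congr (_ + _).
  have dl : differentiable (lsubmx : 'rV[R]_(d + 1) -> 'rV[R]_d) p0.
    exact: differentiable_lsubmx.
  have Dl : 'D_(row_mx v w%:M) (lsubmx : 'rV[R]_(d + 1) -> 'rV[R]_d) p0 = v.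
    have Lc : continuous (lsubmx : 'rV[R]_(d + 1) -> 'rV[R]_d) by exact: continuous_lsubmx.
    by rewrite deriveE // (diff_lin _ Lc) /= row_mxKl.
  apply/matrixP => i j; rewrite !mxE; have [[dr _] [di _]] := CX 1 i j.
  apply: rc_eqP; rewrite !(rc_re_derive, rc_im_derive).
    rewrite (derive_comp_rV (f := lsubmx) (g := fun t => rc_re (X t i j))) ?Dl ?row_mxKl //.
    by exact: dr.
  rewrite (derive_comp_rV (f := lsubmx) (g := fun t => rc_im (X t i j))) ?Dl ?row_mxKl //.
  by exact: di.
have lastE : 'D_(row_mx v w%:M) (fun p : 'rV[R]_(d + 1) => p 0 (rshift d 0)) p0 = w.
  rewrite -(derive_entry (f := id)) ?derive_id ?row_mxEr ?mxE ?eqxx ?mulr1n //.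
have dlast : derivable (fun p : 'rV[R]_(d + 1) => p 0 (rshift d 0)) p0 (row_mx v w%:M).
  by apply: diff_derivable; exact: (C_last 1 O1).1.
apply/matrixP => i j; rewrite mxE [RHS]mxE scalar_entry; apply: rc_eqP; rewrite !(rc_re_derive, rc_im_derive).
  rewrite rc_reN rc_re_real.
  have -> : (fun p : 'rV[R]_(d + 1) =>
      rc_re ((- (rc_of_real (p 0 (rshift d 0)))%:M : 'M[K]_n) i j)) =
      (- (i == j)%:R) \*: (fun p : 'rV[R]_(d + 1) => p 0 (rshift d 0)).
    apply/funext => p; rewrite mxE scalar_entry rc_reN rc_re_real /=.
    by rewrite mulrC -mulNr.
  by rewrite deriveZ // lastE scaleNr mulrC.
rewrite rc_imN rc_im_real oppr0.
under eq_fun do rewrite mxE scalar_entry rc_imN rc_im_real oppr0.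
by rewrite derive_cst.
Qed.

Let trace_pairing_H v A : trace_pairing A (H v) = 'D_v (fun t => trace_pairing A (adjoint U *m X t *m U)) t0.
Proof.
have CU : Ck_mx 1 O (fun t => adjoint U *m X t *m U).
  apply: Ck_mxM => //; last exact: Ck_mx_cst.
  by apply: Ck_mxM => //; exact: Ck_mx_cst.
by rewrite (derive_trace_pairing oO Ot0) // (mx_derive_conj oO Ot0).
Qed.

(** [H] is built from directional derivatives, so its linearity in the direction is a consequence of
    differentiability; it is obtained from the real function that pairs [A] with the compressed
    family. *)
Let trace_H v A :
  trace_pairing A (H v) = \sum_i v 0 i * trace_pairing A (H (delta_mx 0 i)).
Proof.
rewrite (trace_pairing_H v A) derive_rV_sum.
  by apply: eq_bigr => i _; rewrite (trace_pairing_H (delta_mx 0 i) A).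
have CU : Ck_mx 1 O (fun t => adjoint U *m X t *m U).
  apply: Ck_mxM => //; last exact: Ck_mx_cst.
  by apply: Ck_mxM => //; exact: Ck_mx_cst.
by apply: (Ck_trace_pairing oO A CU).1.
Qed.

Let HS v : Sym_mx R b nu (H v).
Proof. by apply: Sym_mx_congr; exact: (Sym_mx_derive Ot0 v XS (CX 1)). Qed.

Let BH v : trace_pairing B (H v) = 0.
Proof.
have : trace_perp (range H) B.
  by rewrite HB; exists 1 => //; rewrite rmorph1 scale1r.
by move=> [_ /(_ (H v))]; rewrite /trace_pairing => -> //; rewrite rc_re0.
Qed.

Let spanB A : Sym_mx R b nu A ->
  (forall i, trace_pairing A (H (delta_mx 0 i)) = 0) -> real_span B A.
Proof.
move=> AS AH; rewrite -HB; split=> // _ [v _ <-].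
apply: rc_eqP; rewrite ?rc_im0 ?rc_re0; last exact: Sym_tr_real.
by rewrite -/(trace_pairing A (H v)) trace_H big1 // => i _; rewrite AH mulr0.
Qed.

Let shiftedS p : Sym_mx R b n (shifted p).
Proof. by apply: Sym_mxB => //; exact: Sym_mx_scalar. Qed.

Let mult_rank t m : (nu + m)%N = n ->
  eig_mult k (X t) = nu <-> \rank (X t - (rc_of_real (eigval k (X t)))%:M) = m.
Proof.
move=> nm; rewrite eig_mult_rank; have := rank_leq_row (X t - (rc_of_real (eigval k (X t)))%:M).
by split; lia.
Qed.

(** Isolates what the geometric part consumes. The D equations g = 0 take values in the row space of
    their Jacobian [J] at [t0], whose rank is D - 1, so they amount to D - 1 independent ones. *)
Theorem local_model :
  let D := real_dim (Sym_mx R b nu) in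
  exists (T : set 'rV[R]_d) (l : 'rV[R]_d -> R) (g : 'rV[R]_d -> 'rV[R]_D) (J : 'M[R]_(d, D)),
  [/\ [/\ open T, T t0 & T `<=` O],
      smooth_on T l /\ (forall v, 'D_v l t0 = 0),
      [/\ smooth_on T g, forall v, 'D_v g t0 = v *m J, \rank J = D.-1 &
          forall t, T t -> (g t <= J)%MS],
      forall t, T t -> (eig_mult k (X t) = nu <-> g t = 0) &
      forall t, T t -> g t = 0 -> eigval k (X t) = l t].
Proof.
move=> D; have [e eP] : exists e : 'I_D -> 'M[K]_nu, real_basis (Sym_mx R b nu) e.
  exact: real_dimP.
have rU : \rank U = nu.
  apply/eqP; rewrite eqn_leq rank_leq_col /=.
  by have := mxrankM_maxr (adjoint U) U; rewrite (UE.1) mxrank1.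
have [m [W [nm Qf]]] := complement_columns rU.
pose p0 : 'rV[R]_(d + 1) := row_mx t0 l0%:M.
pose Phi p := schur U W (shifted p).
have rk0 : \rank (X t0 - (rc_of_real l0)%:M) = m by apply/mult_rank.
(* At the base point all blocks involving [U] vanish, so the m by m block of [W] carries the whole
   rank m and is invertible. *)
have Du0 : adjoint W *m shifted p0 *m W \in unitmx.
  have := rank_adjoint_congr (X t0 - (rc_of_real l0)%:M) Qf.
  rewrite adjoint_congr_block UX -(mulmxA (adjoint W)) XU mulmx0 !mul0mx rank_diag_block_mx.
  rewrite mxrank0 add0n rk0 -row_free_unit shifted_pair => rD.
  by rewrite /row_free rD.
pose O2 := [set p | O1 p /\ adjoint W *m shifted p *m W \in unitmx].
have CW j : Ck_mx j O1 (fun p => adjoint W *m shifted p *m W).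
  apply: Ck_mxM => //; last exact: Ck_mx_cst.
  by apply: Ck_mxM => //; exact: Ck_mx_cst.
have oO2 : open O2 by exact: open_unitmx.
have O2p0 : O2 p0 by split=> //; rewrite /O1 /= row_mxKl.
have Xc i j : rc_re (X t i j) @[t --> t0] --> rc_re (X t0 i j) /\
    rc_im (X t i j) @[t --> t0] --> rc_im (X t0 i j).
  have [re im] := CX 0 i j.
  by split; [exact: (Ck_on_continuous re Ot0)|exact: (Ck_on_continuous im Ot0)].
have [e1 e10 iso] := eigval_isolated XS (XS t0) Xc k.
have /nbhs_ballP [r0 /= r00 r0O] : nbhs p0 O2 by exact: open_nbhs_nbhs.
(* [r0] keeps the block of [W] invertible; [e1] is the distance within which [eigval_isolated]
   recognizes the eigenvalue. *)
pose r := Num.min r0 e1; have r_gt0 : 0 < r by rewrite lt_min r00.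
pose O3 := ball p0 r : set 'rV[R]_(d + 1).
have oO3 : open O3 by exact: ball_open.
have O3O2 : O3 `<=` O2.
  by move=> p; rewrite /O3 -ball_normE /= lt_min => /andP[pr _]; apply: r0O; rewrite -ball_normE.
have O3p0 : O3 p0 by exact: ballxx.
have O3P t a : O3 (row_mx t a%:M) <-> ball t0 r t /\ ball l0 r a by exact: ball_row_mx.
have Yu p : O3 p -> adjoint W *m shifted p *m W \in unitmx by move=> /O3O2 [].
have CY j : Ck_mx j O3 shifted.
  move=> i i'; have [re im] := C_shifted j i i'.
  by split; [apply: Ck_on_subset re|apply: Ck_on_subset im] => p /O3O2 [].
have CPhi j : Ck_mx j O3 Phi by exact: Ck_schur.
have DPhi v w : mx_derive (row_mx v w%:M) Phi p0 = H v - (rc_of_real w)%:M.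
  rewrite (mx_derive_schur oO3 Yu) //; [|by rewrite shifted_pair XU|by rewrite shifted_pair UX].
  rewrite derive_shifted mulmxBr mulmxBl -/(H v); congr (_ - _).
  by rewrite scalar_mxC -mulmxA UE.1 mulmx1.
have Phi0 : Phi p0 = 0 by rewrite /Phi /schur shifted_pair UX !mul0mx subrr.
pose h A p := trace_pairing A (Phi p).
have Ch A : smooth_on O3 (h A) by move=> j; exact: Ck_trace_pairing.
have Dh A v w : 'D_(row_mx v w%:M) (h A) p0 = trace_pairing A (H v - (rc_of_real w)%:M).
  by rewrite (derive_trace_pairing oO3 O3p0) ?DPhi.
have pair_scalar A w v : trace_pairing A (H v - (rc_of_real w)%:M) =
    trace_pairing A (H v) - w * rc_re (\tr A).
  rewrite /trace_pairing mulmxBr linearB /= rc_reD rc_reN; congr (_ - _).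
  rewrite scalar_mxC mul_scalar_mx linearZ /= rc_reM rc_re_real rc_im_real.
  by rewrite mul0r subr0.
have trB := posdef_trace_gt0 nu0 Bp.
have pair0 A : trace_pairing A 0 = 0 by rewrite /trace_pairing mulmx0 linear0 rc_re0.
have [||T0 [l [e2 [oT0 T0t0 sl lt0 [e20 lP]]]]] :=
    implicit_function_scalar oO3 O3p0 (Ch B).
- by rewrite /h Phi0 pair0.
- by rewrite Dh pair_scalar BH sub0r mul1r oppr_eq0 gt_eqF.
pose graph t : 'rV[R]_(d + 1) := row_mx t (l t)%:M.
have graph0 : graph t0 = p0 by rewrite /graph lt0.
(* The first condition identifies a number of the right multiplicity with the eigenvalue. The second
   places the eigenvalue itself within reach of the uniqueness of [l] ([e2]) and inside the domain
   of Phi ([r]). *)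
pose N t := (forall a, `|a - l0| < e1 ->
    \rank (X t - (rc_of_real a)%:M) = \rank (X t0 - (rc_of_real l0)%:M) ->
    eigval k (X t) = a) /\ `|eigval k (X t) - l0| < Num.min e2 r.
have Nt0 : nbhs t0 N.
  near=> t; split; first by near: t; exact: iso.
  near: t; apply: filterS (eigval_near XS (XS t0) Xc _) => [t Ht|]; first exact: Ht.
  by rewrite lt_min e20.
pose T := T0 `&` interior N.
have oT : open T by apply: openI => //; exact: open_interior.
have Tt0 : T t0 by split.
have TN t : T t -> N t by move=> [_ /nbhs_singleton].
have T_O3 t : T t -> O3 (graph t) by move=> [/lP []].
have hB t : T t -> h B (graph t) = 0 by move=> [/lP []].
have TO : T `<=` O.
  by move=> t /T_O3 /O3O2 [] /=; rewrite /O1 /= row_mxKl.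
have slT j : Ck_on j T l by apply: Ck_on_subset (sl j) => t [].
have dl : differentiable l t0 by exact: (slT 1%N).1.
have dgraph : differentiable graph t0 by exact: (Ck_on_graph oT (slT 1%N)).1.
have Dgraph A v : 'D_v (h A \o graph) t0 =
    trace_pairing A (H v) - 'D_v l t0 * rc_re (\tr A).
  have dhA : differentiable (h A) (graph t0) by rewrite graph0; exact: (Ch A 1%N).1.
  by rewrite (derive_comp_rV (f := graph)) // derive_graph // graph0 Dh pair_scalar.
(* Differentiating h B = 0 along the graph gives <B, H v> - dl(v) tr B = 0, where the first term
   vanishes by [BH]. *)
have dl0 v : 'D_v l t0 = 0.
  have : 'D_v (h B \o graph) t0 = 'D_v (fun=> 0 : R) t0.
    by apply: near_eq_derive; exact: (open_near_eq oT hB).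
  rewrite Dgraph BH sub0r (derive_cst (0 : R)) => /eqP.
  by rewrite oppr_eq0 mulf_eq0 (gt_eqF trB) orbF => /eqP.
(* The entries are pairings with the basis [e], not coordinates in it. As the pairing is definite on
   symmetric matrices, [g] vanishes exactly where Phi vanishes on the graph. *)
pose g t : 'rV[R]_D := \row_j h (e j) (graph t).
have sg : smooth_on T g.
  move=> j; apply: Ck_on_mx => // i i'; under eq_fun do rewrite mxE.
  exact: (Ck_on_comp oT oO3 T_O3 (Ck_on_graph oT (slT j)) (Ch _ j)).
pose J := \matrix_(i < d, j < D) trace_pairing (e j) (H (delta_mx 0 i)).
have B0 : B != 0.
  by apply: contraTneq trB => ->; rewrite linear0 rc_re0 ltxx.
have [rJ gJ] := rank_trace_perp eP B0 BS (fun i => BH (delta_mx 0 i)) spanB.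
have Phi_eq0 t : T t -> (g t = 0 <-> Phi (graph t) = 0).
  move=> Tt; split=> [gt|Pt]; last by apply/rowP => j; rewrite !mxE /h Pt pair0.
  apply: (real_basis_pairing_inj eP); first exact: Sym_schur.
  by move=> j; move/rowP/(_ j): gt; rewrite !mxE.
have eigE t : T t -> g t = 0 -> eigval k (X t) = l t /\ eig_mult k (X t) = nu.
  move=> Tt /(Phi_eq0 _ Tt) Pt; have O3t := T_O3 _ Tt.
  have rk : \rank (X t - (rc_of_real (l t))%:M) = m.
    by rewrite -shifted_pair (rank_schur Qf (Yu _ O3t)) -/(Phi _) Pt mxrank0 addn0.
  have ll : eigval k (X t) = l t.
    apply: (TN _ Tt).1; last by rewrite rk rk0.
    have [_] := (O3P _ _).1 O3t; rewrite -ball_normE /= distrC lt_min.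
    by move=> /andP[].
  split; first exact: ll.
  by apply/(mult_rank t nm); rewrite ll.
have Dg v : 'D_v g t0 = v *m J.
  have dg : differentiable g t0 by exact: (sg 1%N).1.
  apply/rowP => j; rewrite derive_entry //.
  under eq_fun do rewrite mxE.
  rewrite Dgraph dl0 mul0r subr0 trace_H mxE; apply: eq_bigr => i _.
  by rewrite mxE.
exists T, l, g, J; split; [by split|by split| | |].
- by split=> // t Tt; apply: gJ; exact: hB.
- move=> t Tt; split=> [mt|gt]; last exact: (eigE t Tt gt).2.
  pose a := eigval k (X t).
  have [_ al] := TN _ Tt; move: al; rewrite lt_min => /andP[ae2 ar].
  have O3a : O3 (row_mx t a%:M).
    apply/O3P; split; first by case: ((O3P _ _).1 (T_O3 _ Tt)).
    by rewrite -ball_normE /= distrC.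
  have Pa : Phi (row_mx t a%:M) = 0.
    apply/eqP; rewrite -mxrank_eq0 -(eqn_add2l m) addn0 -(rank_schur Qf (Yu _ O3a)).
    by rewrite shifted_pair; apply/eqP; apply: (mult_rank t nm).1 mt.
  (* Vanishing of Phi at (t, a) yields the single equation that defines [l], and its uniqueness then
     forces a = l t. *)
  have aE : a = l t.
    have [_ _] := lP t (Tt.1); apply=> //.
    by rewrite /h Pa pair0.
  by apply/(Phi_eq0 _ Tt); rewrite /graph -aE.
- by move=> t Tt gt; exact: (eigE t Tt gt).1.
Unshelve. all: by end_near. Qed.

End LocalModel.

(** * Straightening and slice charts *)

Section Straightening.
Context {R : realType}.

Lemma range_slice_incl d m (y : 'rV[R]_d) : (m <= d)%N ->
  range (@slice_incl R d m) y <-> y *m copid_mx m = 0.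
Proof.
move=> md; split=> [[s _ <-]|y0].
  by rewrite /slice_incl -mulmxA mul_pid_mx_copid // mulmx0.
exists (y *m pid_mx m) => //; rewrite /slice_incl -mulmxA pid_mx_id //.
by move/eqP: y0; rewrite /copid_mx mulmxBr mulmx1 subr_eq0 => /eqP.
Qed.

(** [pid_mx r] selects the first r coordinates, but [slice_incl] requires the last r to vanish;
    reversing the order of coordinates reconciles the two conventions. *)
Lemma rev_perm_copid d r : (r <= d)%N ->
  perm_mx (perm (@rev_ord_inj d)) *m copid_mx (d - r) =
  pid_mx r *m perm_mx (perm (@rev_ord_inj d)) :> 'M[R]_d.
Proof.
move=> rd; set s := perm _.
have -> : perm_mx s = perm_mx (s^-1)^-1%g :> 'M[R]_d by rewrite invgK.
rewrite -[RHS]col_permE invgK -row_permE; apply/matrixP => i j; rewrite !mxE.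
have -> : (i == (s^-1)%g j :> nat) = (s i == j).
  by rewrite val_eqE -[LHS](inj_eq (@perm_inj _ s)) permKV.
rewrite val_eqE.
have [_|_] := eqVneq (s i) j; last by rewrite subr0.
rewrite permE /=; have -> : (d - i.+1 < d - r)%N = ~~ (i < r)%N.
  by have := ltn_ord i; lia.
by case: (i < r)%N; rewrite /= ?subr0 ?subrr.
Qed.

(** Write J = L pid_r Q. In [psi], the summand with [A] keeps d - r linear coordinates and the one
    with [C] fills the other r with combinations of the entries of [g]. The choice makes A + J C
    equal to the invertible matrix L Z, [Z] being the reversal of coordinates. *)
Lemma straighten d D (T : set 'rV[R]_d) t0 (g : 'rV[R]_d -> 'rV[R]_D) (J : 'M[R]_(d, D)) :
  open T -> T t0 -> smooth_on T g -> (forall v, 'D_v g t0 = v *m J) ->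
  (forall t, T t -> (g t <= J)%MS) ->
  exists (V : set 'rV[R]_d) (psi chi : 'rV[R]_d -> 'rV[R]_d),
  [/\ [/\ open V, V t0, V `<=` T & open (psi @` V)],
      smooth_on V psi, smooth_on (psi @` V) chi,
      forall t, V t -> chi (psi t) = t &
      forall t, V t -> (g t = 0 <-> range (@slice_incl R d (d - \rank J)) (psi t))].
Proof.
move=> oT Tt0 sg gJ gsub; set r := \rank J.
have rd : (r <= d)%N by exact: rank_leq_row.
have rD : (r <= D)%N by exact: rank_leq_col.
pose L := col_ebase J; pose Q := row_ebase J.
have Lu : L \in unitmx by exact: col_ebase_unit.
have Qu : Q \in unitmx by exact: row_ebase_unit.
have JE : J = L *m pid_mx r *m Q by rewrite mulmx_ebase.
pose Z : 'M[R]_d := perm_mx (perm (@rev_ord_inj d)).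
have Zu : Z \in unitmx by exact: unitmx_perm.
pose A := L *m copid_mx r *m Z; pose C : 'M[R]_(D, d) := invmx Q *m pid_mx r *m Z.
pose psi t := t *m A + g t *m C.
have sA j (S : set 'rV[R]_d) : Ck_on j S (fun t => t *m A).
  by apply: (@Ck_on_linear _ j _ _ _ (mulmxr A)); exact: continuous_mulmxr.
have spsi : smooth_on T psi.
  by move=> j; apply: Ck_onD => //; apply: Ck_on_mulmxr => //; exact: sg.
have dg : differentiable g t0 by exact: (sg 1%N).1.
have Dpsi v : 'D_v psi t0 = v *m (L *m Z).
  have AC : A + J *m C = L *m Z.
    rewrite JE /C !mulmxA mulmxK // -(mulmxA L) pid_mx_id // /A -mulmxDl -mulmxDr.
    by rewrite /copid_mx subrK mulmx1.
  have dA : differentiable (fun t => t *m A) t0 by exact: (sA 1%N setT).1.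
  pose LC : {linear 'rV[R]_D -> 'rV[R]_d} := mulmxr C.
  have LCc : continuous LC by exact: continuous_mulmxr.
  pose LA : {linear 'rV[R]_d -> 'rV[R]_d} := mulmxr A.
  have LAc : continuous LA by exact: continuous_mulmxr.
  have dgC : differentiable (LC \o g) t0.
    by apply: differentiable_comp => //; exact: linear_differentiable.
  rewrite (deriveD (f := LA) (g := LC \o g)); [|exact: diff_derivable|exact: diff_derivable].
  rewrite derive_comp_rV //; last exact: linear_differentiable.
  rewrite deriveE // (diff_lin _ LAc) deriveE; last exact: linear_differentiable.
  by rewrite (diff_lin _ LCc) /= gJ -mulmxA -mulmxDr AC.
have LZu : L *m Z \in unitmx by rewrite unitmx_mul Lu.
have [V [chi [oV VT Vt0 oim [chiK schi]]]] := inverse_function oT Tt0 spsi LZu Dpsi.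
exists V, psi, chi; split=> //.
  by move=> j; exact: Ck_on_subset (spsi j).
move=> t Vt; rewrite range_slice_incl ?leq_subr //.
have [u uE] := submxP (gsub _ (VT _ Vt)).
(* Since [g t] lies in the row space of [J], multiplying by the inverse of [Q] moves it into the
   first r coordinates, so truncating there loses nothing. *)
have gQ : g t *m invmx Q *m pid_mx r *m (pid_mx r : 'M[R]_(d, D)) = g t *m invmx Q.
  by rewrite uE JE !mulmxA mulmxK // -!mulmxA !pid_mx_id // !mulmxA.
have -> : psi t *m copid_mx (d - r) = g t *m invmx Q *m (pid_mx r : 'M[R]_(D, d)) *m Z.
  have AE : A *m copid_mx (d - r) = 0.
    rewrite /A -!mulmxA rev_perm_copid // (mulmxA (copid_mx r)) mul_copid_mx_pid //.
    by rewrite mul0mx mulmx0.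
  have CE : C *m copid_mx (d - r) = invmx Q *m pid_mx r *m Z.
    rewrite /C -!mulmxA rev_perm_copid // (mulmxA (pid_mx r)) pid_mx_id //.
  by rewrite /psi mulmxDl -(mulmxA t A) AE mulmx0 add0r -(mulmxA (g t) C) CE !mulmxA.
split=> [->|gZ]; first by rewrite !mul0mx.
have : g t *m invmx Q *m pid_mx r = 0 :> 'rV[R]_d by rewrite -(mulmxK Zu (_ *m _)) gZ mul0mx.
move=> g0; move: gQ; rewrite g0 mul0mx => gQ.
by rewrite -(mulmxKV Qu (g t)) -gQ mul0mx.
Qed.

End Straightening.

(** * Charts obtained by changing coordinates *)

Section Charts.
Context {R : realType} {d : nat} {M : topologicalType}.

Lemma open_preimage_in (T T' : topologicalType) (f : T -> T') (D : set T) (V : set T') :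
  open D -> (forall x, D x -> {for x, continuous f}) -> open V ->
  open [set x | D x /\ V (f x)].
Proof.
move=> oD fc oV; rewrite openE => x [Dx Vfx].
have VN : nbhs (f x) V by exact: open_nbhs_nbhs.
have := fc _ Dx _ VN => H.
near=> y; split; first by near: y; exact: open_nbhs_nbhs.
by near: y; exact: H.
Unshelve. all: by end_near. Qed.

Lemma chart_cont (c : chart R d M) x : chart_dom c x -> {for x, continuous c}.
Proof. by move=> cx; apply: (@chart_fun_continuous _ _ _ c); rewrite inE. Qed.

Lemma chart_inv_cont (c : chart R d M) z : chart_img c z -> {for z, continuous (chart_inv c)}.
Proof. by move=> cz; apply: (@chart_inv_continuous _ _ _ c); rewrite inE. Qed.

Lemma chartK (c : chart R d M) x : chart_dom c x -> chart_inv c (c x) = x.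
Proof. by move=> cx; apply: (@chart_funK _ _ _ c); rewrite inE. Qed.

Lemma open_chart_image (c : chart R d M) (V : set M) :
  open V -> open (c @` (chart_dom c `&` V)).
Proof.
move=> oV.
have -> : c @` (chart_dom c `&` V) = [set z | chart_img c z /\ V (chart_inv c z)].
  apply/seteqP; split=> [_ [y [cy Vy] <-]|_ [[y cy <-]]].
    by split; [exists y|rewrite chartK].
  by rewrite chartK // => Vy; exists y.
by apply: open_preimage_in => //; [exact: chart_img_open|exact: chart_inv_cont].
Qed.

Section Recoordinatize.
Variables (c : chart R d M) (V : set 'rV[R]_d) (psi chi : 'rV[R]_d -> 'rV[R]_d).
Hypotheses (oV : open V) (VO : V `<=` chart_img c) (oim : open (psi @` V)).
Hypotheses (spsi : smooth_on V psi) (schi : smooth_on (psi @` V) chi).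
Hypothesis chiK : forall t, V t -> chi (psi t) = t.

Definition recoord_dom : set M := [set y | chart_dom c y /\ V (c y)].

Lemma recoord_img : (psi \o c) @` recoord_dom = psi @` V.
Proof.
apply/seteqP; split=> [_ [y [cy Vy] <-]|_ [t Vt <-]]; first by exists (c y).
have [y cy yt] := VO Vt; exists y; last by rewrite /= yt.
by split; rewrite // yt.
Qed.

Lemma recoord_dom_open : open recoord_dom.
Proof.
by apply: open_preimage_in => //; [exact: chart_dom_open|exact: chart_cont].
Qed.

Lemma recoord_img_open : open ((psi \o c) @` recoord_dom).
Proof. by rewrite recoord_img. Qed.

Lemma recoord_fun_continuous : {in recoord_dom, continuous (psi \o c)}.
Proof.
move=> y /set_mem [cy Vy]; apply: continuous_comp; first exact: chart_cont.
exact: (Ck_on_continuous (spsi 0)).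
Qed.

Lemma recoord_inv_continuous :
  {in (psi \o c) @` recoord_dom, continuous (chart_inv c \o chi)}.
Proof.
move=> z /set_mem; rewrite recoord_img => Vz.
apply: continuous_comp; first exact: (Ck_on_continuous (schi 0)).
by apply: chart_inv_cont; move: Vz => [t Vt <-]; rewrite chiK //; exact: VO.
Qed.

Lemma recoord_funK : {in recoord_dom, cancel (psi \o c) (chart_inv c \o chi)}.
Proof. by move=> y /set_mem [cy Vy] /=; rewrite chiK // chartK. Qed.

Definition recoord : chart R d M :=
  Chart recoord_dom_open recoord_img_open recoord_fun_continuous
        recoord_inv_continuous recoord_funK.

(** Transitions with a chart c' of the atlas factor through [c]: one is the transition from [c] to
    c' preceded by [chi], the other the transition from c' to [c] followed by [psi]. *)
Lemma recoord_smooth (A : smooth_structure R d M) : atlas A c -> smooth_chart A recoord.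
Proof.
move=> Ac c' Ac'; split=> j.
  apply: (Ck_on_comp_mx (U' := c @` (chart_dom c `&` chart_dom c')) (f := chi)
           (g := c' \o chart_inv c)).
  - by apply: (@open_chart_image recoord); exact: chart_dom_open.
  - by apply: open_chart_image; exact: chart_dom_open.
  - move=> _ [y [[cy Vy] c'y] <-] /=.
    by rewrite chiK //; exists y.
  - apply: Ck_on_subset (schi j) => _ [y [[cy Vy] c'y] <-] /=.
    by exists (c y).
  - exact: (atlas_compatible Ac Ac').
apply: (Ck_on_comp_mx (U' := V) (f := c \o chart_inv c') (g := psi)).
- by apply: open_chart_image; exact: recoord_dom_open.
- exact: oV.
- by move=> _ [y [c'y [cy Vy]] <-] /=; rewrite chartK.
- apply: Ck_on_subset (atlas_compatible Ac' Ac j) => _ [y [c'y [cy Vy]] <-].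
  by exists y.
- exact: spsi.
Qed.

End Recoordinatize.

(** * Restriction of a function to a submanifold *)

Section SliceFunction.
Variables (A : smooth_structure R d M) (s : nat) (S : set M) (f : M -> R).
Variables (c0 : chart R d M) (T : set 'rV[R]_d) (l : 'rV[R]_d -> R).
Hypotheses (Ac0 : atlas A c0) (oT : open T) (sl : smooth_on T l).
Hypothesis Sc0 : forall y, S y -> [/\ chart_dom c0 y, T (c0 y) & f y = l (c0 y)].

Let E (c : chart R d M) : set 'rV[R]_(d - s) := [set t | chart_img c (slice_incl t)].
Let q (c : chart R d M) (t : 'rV[R]_(d - s)) := c0 (chart_inv c (slice_incl t)).

Let oE c : open (E c).
Proof.
by apply: open_comp => [t _|]; [exact: continuous_mulmxr|exact: chart_img_open].
Qed.

Let slice_point c t : slice_chart A s S c -> E c t ->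
  exists y, [/\ chart_dom c y, S y & c y = slice_incl t].
Proof.
move=> [_ cS] Et; have : (chart_img c `&` range (@slice_incl R d (d - s))) (slice_incl t).
  by split=> //; exists t.
by rewrite -cS => -[y [cy Sy] yt]; exists y.
Qed.

Let q_smooth c : slice_chart A s S c -> smooth_on (E c) (q c).
Proof.
move=> cS j; apply: (Ck_on_comp_mx (U' := c @` (chart_dom c `&` chart_dom c0))
   (f := @slice_incl R d (d - s)) (g := c0 \o chart_inv c)).
- exact: oE.
- by apply: open_chart_image; exact: chart_dom_open.
- move=> t /(slice_point cS) [y [cy Sy <-]]; exists y => //; split=> //.
  by have [] := Sc0 Sy.
- by apply: (@Ck_on_linear _ j _ _ _ (mulmxr (pid_mx (d - s)))); exact: continuous_mulmxr.
- exact: (cS.1 c0 Ac0).1 j.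
Qed.

Let q_T c t : slice_chart A s S c -> E c t -> T (q c t) /\ restr_coord (s := s) f c t = l (q c t).
Proof.
move=> cS /(slice_point cS) [y [cy Sy yt]].
by rewrite /q /restr_coord -yt chartK //; have [] := Sc0 Sy.
Qed.

Let restr_smooth c : slice_chart A s S c -> smooth_on (E c) (l \o q c).
Proof.
move=> cS j; apply: (Ck_on_comp (U' := T)) => //; last exact: q_smooth.
by move=> t Et; exact: (q_T cS Et).1.
Qed.

(** The claim concerns every slice chart of S. In each one the restriction is [l] composed with the
    smooth map [q], the transition to [c0] along the slice; ambient smoothness of [f] is never
    invoked. *)
Lemma slice_function_smooth : smooth_on_submanifold A s S f.
Proof.
move=> c cS j; apply: eq_Ck_on (restr_smooth cS j) => [|t Et]; first exact: oE.
exact/esym/(q_T cS Et).2.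
Qed.

Lemma slice_function_critical x : (forall v, 'D_v l (c0 x) = 0) ->
  critical_on_submanifold A s S f x.
Proof.
move=> lx c cS cx t tx.
have Et : E c t by rewrite /E /= tx; exists x.
have qt : q c t = c0 x by rewrite /q tx chartK.
have Tt := (q_T cS Et).1.
apply/funext => v.
have dr : differentiable (restr_coord (s := s) f c) t.
  exact: (slice_function_smooth cS 1%N).1.
rewrite -deriveE // (_ : 'D_v _ t = 'D_v (l \o q c) t); last first.
  apply: near_eq_derive.
  have : nbhs t (E c) by exact: open_nbhs_nbhs.
  by apply: filterS => u Eu; exact: (q_T cS Eu).2.
rewrite derive_comp_rV ?qt ?lx //; first exact: (q_smooth cS 1%N).1.
by rewrite -qt; exact: (sl 1%N).1.
Qed.

End SliceFunction.
End Charts.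

(** * From the chart back to the manifold *)

Theorem proposition1p9 (R : realType) (b : base_field)
    (d : nat) (M : topologicalType) (A : smooth_structure R d M)
    (n : nat) (F : M -> 'M[rc_scalar R b]_n) (k : 'I_n) (x : M)
    (nu : nat) (U : 'M[rc_scalar R b]_(n, nu)) :
  smooth_family A F ->
  (1 <= nu)%N ->
  eig_mult k (F x) = nu ->
  isometry_onto U (eig_cspace k (F x)) ->
  condition_N A F x U ->
  let s := (real_dim (Sym_mx R b nu)).-1 in
  exists S : set M,
    [/\ \forall y \near x, eig_mult k (F y) = nu <-> S y,
        submanifold A s S,
        smooth_on_submanifold A s S (fun y => eigval k (F y)) &
        critical_on_submanifold A s S (fun y => eigval k (F y)) x].
Proof.
move=> [FS sF] nu0 mult0 UE [B Bp HB] s.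
pose c0 := chart_at A x; pose t0 := c0 x.
have Ac0 : atlas A c0 := s2valP (cid2 (atlas_cover A x)).
have c0x : chart_dom c0 x := s2valP' (cid2 (atlas_cover A x)).
(* Outside the image of [c0] the values are those of F at arbitrary points: still symmetric, while
   smoothness is claimed on the image only. *)
pose X t := F (chart_inv c0 t).
have Xt0 : X t0 = F x by rewrite /X chartK.
have CX j : Ck_mx j (chart_img c0) X.
  by move=> i i'; have [re im] := sF i i'; split; [exact: (re _ Ac0 j)|exact: (im _ Ac0 j)].
have Ot0 : chart_img c0 t0 by exists x.
have MX : eig_mult k (X t0) = nu by rewrite Xt0.
have UEX : isometry_onto U (eig_cspace k (X t0)) by rewrite Xt0.
have dE v : dfamily A F (x := x) v = mx_derive (v : 'rV[R]_d) X t0.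
  by apply/matrixP => i j; rewrite !mxE.
have HBX : trace_perp (range (fun v => adjoint U *m mx_derive v X t0 *m U)) = real_span B.
  suff <- : Hop A F (x := x) U = (fun v => adjoint U *m mx_derive v X t0 *m U) by [].
  by apply/funext => v; rewrite -dE.
have [T [l [g [J [[oT Tt0 TO] [sl dl0] [sg gJ rJ gsub] multE eigE]]]]] :=
  local_model (@chart_img_open _ _ _ c0) Ot0 CX (fun t => FS _) nu0 MX UEX Bp HBX.
have [V [psi [chi [[oV Vt0 VT oim] spsi schi chiK slice]]]] := straighten oT Tt0 sg gJ gsub.
rewrite rJ -/s in slice.
have VO : V `<=` chart_img c0 by move=> t /VT /TO.
pose c := recoord oV VO oim spsi schi chiK.
(* Cutting S out inside the domain of [c] lets this one chart serve as slice chart at all its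
   points. *)
pose S := [set y | chart_dom c y /\ g (c0 y) = 0].
have FX y : chart_dom c0 y -> F y = X (c0 y) by move=> cy; rewrite /X chartK.
have Sc0 y : S y -> [/\ chart_dom c0 y, T (c0 y) & eigval k (F y) = l (c0 y)].
  move=> [[cy Vy] gy]; split=> //; first exact: VT.
  by rewrite (FX y cy); exact: (eigE _ (VT _ Vy) gy).
have cslice : slice_chart A s S c.
  split; first exact: recoord_smooth.
  apply/seteqP; split=> [_ [y [cy [_ gy]] <-]|_ [[y cy <-] ys]].
    by split; [exists y|apply/slice => //; case: cy].
  by exists y => //; split=> //; split=> //; apply/slice => //; case: cy.
exists S; split.
- have : nbhs x (chart_dom c).
    by apply: open_nbhs_nbhs; split; [exact: chart_dom_open|split].
  apply: filterS => y cy; have [c0y Vy] := cy.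
  rewrite (FX y c0y); split=> [mt|[_ gy]]; last exact: (multE _ (VT _ Vy)).2 gy.
  by split; [exact: cy|exact: (multE _ (VT _ Vy)).1 mt].
(* The bound s <= d holds because s is the rank of [J], which has d rows. *)
- split; first by rewrite /s -rJ rank_leq_row.
  by move=> p Sp; exists c => //; case: Sp.
- exact: slice_function_smooth Ac0 oT sl Sc0.
- exact: (slice_function_critical (x := x) Ac0 oT sl Sc0 dl0).
Qed.
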